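(* Let $(M,\mathbf m)$ be a metric projective manifold of dimension $n\ge2$ with Weyl nullity and let $g\in\mathbf m$ be such that $B^g\ne0$ is constant. Then solutions $\sigma^{ab}\in\Gamma(S^2TM(-2))$ of the metrisability equation $\operatorname{trace-free}(\nabla_a\sigma^{bc})=0$ are in one-to-one correspondence with solutions of the Gallot–Obata–Tanno equation $$\nabla_a\nabla_b\nabla_cf+B^g\,(2g_{bc}\nabla_af+g_{ab}\nabla_cf+g_{ca}\nabla_bf)=0,$$ where $\nabla$ is the Levi-Civita connection of $g$. Furthermore, in the scale of the fixed metric $g$, a solution $\sigma^{ab}$ of the metrisability equation with $\mu^a_x$ not zero at a given point $x\in M$ is equivalent (under this correspondence) to a solution $f$ of the Gallot–Obata–Tanno equation with $df_x$ not zero. Here $\mu^a=-\frac1{n+1}\nabla_b\sigma^{ba}$.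
   Context: Manifolds are smooth and connected; metrics have arbitrary signature; indices are abstract. Two metrics are projectively equivalent if they have the same geodesics up to reparametrisation; a metric projective structure $\mathbf m$ is an equivalence class of projectively equivalent metrics. For the Levi-Civita connection $\nabla$ of $g$: $[\nabla_\ell,\nabla_k]v^j=R^j{}_{i\ell k}v^i$, $R_{jk}=R^a{}_{jak}$, $\mathsf P_{jk}=\frac1{n-1}R_{jk}$, $\mathsf P^i{}_j=g^{ik}\mathsf P_{kj}$. The projective Weyl tensor $W^i{}_{jk\ell}=R^i{}_{jk\ell}+\delta^i_\ell\mathsf P_{jk}-\delta^i_k\mathsf P_{j\ell}$ is the same for all $g\in\mathbf m$. $(M,\mathbf m)$ has Weyl nullity if at every $x$ there is $0\ne v\in T_xM$ with $W^i{}_{jk\ell}v^j=0$. Then each $g\in\mathbf m$ determines a function $B^g$ by $\mathsf P^i{}_jv^j=B^gv^i$ for all $v$ in the nullity (independent of $v$). $\mathcal E(1)$ is the positive $(2n+2)$-nd root of $(\Lambda^nTM)^2$, $\mathcal E(w)$ its real powers, $\mathcal B(w)=\mathcal B\otimes\mathcal E(w)$. The metrisability equation is equivalent to $\nabla_a\sigma^{bc}+\delta^b_a\mu^c+\delta^c_a\mu^b=0$ with $\mu^a=-\frac1{n+1}\nabla_b\sigma^{ba}$. *)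

(* Defs.v *)
From HB Require Import structures.
From mathcomp Require Import all_boot all_order all_algebra.
From mathcomp Require Import all_classical all_reals all_analysis.

Set Implicit Arguments.
Unset Strict Implicit.
Unset Printing Implicit Defensive.

Import Order.TTheory GRing.Theory Num.Theory.
Import numFieldNormedType.Exports.

Local Open Scope classical_set_scope.
Local Open Scope ring_scope.

Section Calculus.
Context {R : realType} {n : nat}.
Implicit Types (F : 'rV[R]_n -> R) (U : set 'rV[R]_n).

Definition partial (j : 'I_n) F : 'rV[R]_n -> R :=
  fun u => 'D_(delta_mx 0 j) F u.

(* For open U this is C^oo on U: every iterated partial derivative exists and
   is Frechet differentiable, in particular continuous. *)
Definition smooth_on U F : Prop :=
  forall (s : seq 'I_n) (u : 'rV[R]_n), U u -> differentiable (foldr partial F s) u.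

End Calculus.

Definition smooth_curve_on {R : realType} (D : set R) (phi : R -> R) : Prop :=
  forall (k : nat) (t : R), D t -> derivable (derive1n k phi) t 1.

Definition open_interval {R : realType} (D : set R) : Prop :=
  [/\ open D, is_interval D & D !=set0].

(* [chart_coord] is meaningful on [chart_dom] only, and [chart_point], its
   inverse, on [chart_img] only. *)
Record chart (R : realType) (n : nat) (M : topologicalType) := Chart {
  chart_dom : set M;
  chart_img : set 'rV[R]_n;
  chart_coord : M -> 'rV[R]_n;
  chart_point : 'rV[R]_n -> M;
  dom_open : open chart_dom;
  img_open : open chart_img;
  coord_img : forall x, chart_dom x -> chart_img (chart_coord x);
  point_dom : forall u, chart_img u -> chart_dom (chart_point u);
  coordK : forall x, chart_dom x -> chart_point (chart_coord x) = x;
  pointK : forall u, chart_img u -> chart_coord (chart_point u) = u;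
  coord_continuous : forall x, chart_dom x -> {for x, continuous chart_coord};
  point_continuous : forall u, chart_img u -> {for u, continuous chart_point}
}.

Section Transition.
Context {R : realType} {n : nat} {M : topologicalType}.
Implicit Types c d : chart R n M.

Definition transition c d (u : 'rV[R]_n) : 'rV[R]_n :=
  chart_coord d (chart_point c u).

Definition overlap c d : set 'rV[R]_n :=
  chart_img c `&` (chart_point c @^-1` chart_dom d).

Definition jac c d (u : 'rV[R]_n) : 'M[R]_n :=
  \matrix_(i, j) partial j (fun w => transition c d w 0 i) u.

End Transition.

(* The smooth structure is given by an atlas, not necessarily maximal. *)
Record manifold (R : realType) (n : nat) := Manifold {
  points :> topologicalType;
  charts : Type;
  atlas : charts -> chart R n points;
  atlas_cover : forall x : points, exists c, chart_dom (atlas c) x;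
  atlas_smooth : forall c d i,
    smooth_on (overlap (atlas c) (atlas d))
              (fun u => transition (atlas c) (atlas d) u 0 i);
  manifold_hausdorff : hausdorff_space points;
  manifold_second_countable : @second_countable points;
  manifold_connected : connected [set: points]
}.

Section Fields.
Context {R : realType} {n : nat} (M : manifold R n).

Definition smooth_function (f : M -> R) : Prop :=
  forall c, smooth_on (chart_img (atlas c)) (f \o chart_point (atlas c)).

(* A weighted bivector field s^{ab}, as its components [s c u a b] in the chart
   [c] at the point of coordinates [u]. *)
Definition field2 : Type := charts M -> 'rV[R]_n -> 'M[R]_n.

Record metric := Metric {
  metric_comp :> charts M -> 'rV[R]_n -> 'M[R]_n;
  metric_sym : forall c u, chart_img (atlas c) u ->
    (metric_comp c u)^T = metric_comp c u;
  metric_nondeg : forall c u, chart_img (atlas c) u -> metric_comp c u \in unitmx;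
  metric_smooth : forall c a b,
    smooth_on (chart_img (atlas c)) (fun u => metric_comp c u a b);
  metric_change : forall c d u, overlap (atlas c) (atlas d) u ->
    metric_comp c u =
      (jac (atlas c) (atlas d) u)^T
      *m metric_comp d (transition (atlas c) (atlas d) u)
      *m jac (atlas c) (atlas d) u
}.

(* Smooth sections of S^2 TM(-2). Under a coordinate change of Jacobian J, a
   section of (Lambda^n TM)^2 is multiplied by (det J)^2, hence a section of
   E(w) by |det J|^(w/(n+1)).
   Components are 0 off the image of the chart, so that a section is determined
   by its values, i.e. equality of [field2]s is equality of sections. *)
Definition is_section_S2TM_m2 (s : field2) : Prop :=
  [/\ forall c u, ~ chart_img (atlas c) u -> s c u = 0,
      forall c u, chart_img (atlas c) u -> (s c u)^T = s c u,
      forall c a b, smooth_on (chart_img (atlas c)) (fun u => s c u a b)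
    & forall c d u, overlap (atlas c) (atlas d) u ->
        let J := jac (atlas c) (atlas d) u in
        s d (transition (atlas c) (atlas d) u) =
          (`|\det J| `^ (- 2 / n.+1%:R)) *: (J *m s c u *m J^T)].

End Fields.

(* Components in one chart; G is the matrix of components of the metric. *)
Section Components.
Context {R : realType} {n : nat} (G : 'rV[R]_n -> 'M[R]_n).
Implicit Types (i j k l a b c : 'I_n) (u : 'rV[R]_n).

Definition christoffel i j k u : R :=
  2^-1 * \sum_l invmx (G u) i l *
    (partial j (fun w => G w l k) u + partial k (fun w => G w l j) u
     - partial l (fun w => G w j k) u).

(* riemann i j k l is R^i_{jkl}, read off from
   [nabla_k, nabla_l] v^i = R^i_{jkl} v^j. *)
Definition riemann i j k l u : R :=
  partial k (christoffel i l j) u - partial l (christoffel i k j) u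
  + \sum_m (christoffel i k m u * christoffel m l j u
            - christoffel i l m u * christoffel m k j u).

Definition ricci j k u : R := \sum_a riemann a j a k u.

Definition schouten j k u : R := (n%:R - 1)^-1 * ricci j k u.

Definition schouten_up i j u : R := \sum_k invmx (G u) i k * schouten k j u.

Definition weyl i j k l u : R :=
  riemann i j k l u + (i == l)%:R * schouten j k u - (i == k)%:R * schouten j l u.

(* nabla_a w_b *)
Definition nabla_form (w : 'I_n -> 'rV[R]_n -> R) a b u : R :=
  partial a (w b) u - \sum_k christoffel k a b u * w k u.

(* nabla_a h_{bc} *)
Definition nabla_form2 (h : 'I_n -> 'I_n -> 'rV[R]_n -> R) a b c u : R :=
  partial a (h b c) u
  - \sum_k christoffel k a b u * h k c u
  - \sum_k christoffel k a c u * h b k u.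

(* nabla_a s^{bc} for s of weight -2: the connection on E(w) induced from
   Lambda^n TM is partial_a + (w/(n+1)) Gamma^k_{ak}. *)
Definition nabla_bivector_m2 (s : 'rV[R]_n -> 'M[R]_n) a b c u : R :=
  partial a (fun w => s w b c) u
  + \sum_k christoffel b a k u * s u k c
  + \sum_k christoffel c a k u * s u b k
  - 2 / n.+1%:R * (\sum_k christoffel k a k u) * s u b c.

(* trace-free part of T_a^{bc} = T_a^{cb} *)
Definition trace_free (T : 'I_n -> 'I_n -> 'I_n -> R) a b c : R :=
  T a b c - n.+1%:R^-1 *
    ((a == b)%:R * \sum_d T d d c + (a == c)%:R * \sum_d T d d b).

End Components.

Section Geometry.
Context {R : realType} {n : nat} {M : manifold R n}.
Implicit Types (g h : metric M) (m : set (metric M)) (c : charts M).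

(* Affinely parametrised geodesics, constant ones included. *)
Definition geodesic g (D : set R) (gam : R -> M) : Prop :=
  forall t, D t ->
    {for t, continuous gam} /\
    forall c, chart_dom (atlas c) (gam t) -> forall i,
      let x (k : 'I_n) (s : R) : R := chart_coord (atlas c) (gam s) 0 k in
      [/\ derivable (x i) t 1, derivable (derive1 (x i)) t 1
        & derive1 (derive1 (x i)) t
          + \sum_j \sum_k christoffel (g c) i j k (chart_coord (atlas c) (gam t))
                          * derive1 (x j) t * derive1 (x k) t = 0].

Definition geodesics_reparam g h : Prop :=
  forall (D : set R) (gam : R -> M), open_interval D -> geodesic g D gam ->
    exists (D' : set R) (phi : R -> R),
      [/\ open_interval D', set_bij D' D phi, smooth_curve_on D' phi,
          (forall t, D' t -> derive1 phi t != 0)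
        & geodesic h D' (gam \o phi)].

Definition projectively_equivalent g h : Prop :=
  geodesics_reparam g h /\ geodesics_reparam h g.

Definition metric_projective_structure m : Prop :=
  exists g, m = [set h | projectively_equivalent g h].

(* v is given by its components in the chart c at the point of coordinates u.
   As W is the same for all metrics in m, the quantifier over h is harmless. *)
Definition weyl_null m c (u v : 'rV[R]_n) : Prop :=
  forall h, m h -> forall i k l, \sum_j weyl (h c) i j k l u * v 0 j = 0.

Definition has_weyl_nullity m : Prop :=
  forall (x : M) c, chart_dom (atlas c) x ->
    exists2 v : 'rV[R]_n, v != 0 & weyl_null m c (chart_coord (atlas c) x) v.

Definition nullity_function m g (Bg : M -> R) : Prop :=
  forall (x : M) c, chart_dom (atlas c) x -> forall v : 'rV[R]_n,
    weyl_null m c (chart_coord (atlas c) x) v ->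
    forall i, \sum_j schouten_up (g c) i j (chart_coord (atlas c) x) * v 0 j
              = Bg x * v 0 i.

Definition metrisability_equation g (s : field2 M) : Prop :=
  forall c u, chart_img (atlas c) u -> forall a b e,
    trace_free (fun a' b' e' => nabla_bivector_m2 (g c) (s c) a' b' e' u) a b e
    = 0.

Definition metrisability_solutions g : set (field2 M) :=
  [set s | is_section_S2TM_m2 s /\ metrisability_equation g s].

Definition mu g (s : field2 M) c (u : 'rV[R]_n) : 'rV[R]_n :=
  \row_a (- (n.+1%:R^-1 * \sum_b nabla_bivector_m2 (g c) (s c) b b a u)).

Definition differential (f : M -> R) c (u : 'rV[R]_n) : 'rV[R]_n :=
  \row_a partial a (f \o chart_point (atlas c)) u.

Definition GOT_equation g (B : M -> R) (f : M -> R) : Prop :=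
  forall c u, chart_img (atlas c) u -> forall a b e,
    let df (k : 'I_n) (w : 'rV[R]_n) : R := differential f c w 0 k in
    nabla_form2 (g c) (nabla_form (g c) df) a b e u
    + B (chart_point (atlas c) u) *
      (2 * g c u b e * df a u + g c u a b * df e u + g c u e a * df b u) = 0.

Definition GOT_solutions g (B : M -> R) : set (M -> R) :=
  [set f | smooth_function f /\ GOT_equation g B f].

End Geometry.

(* Main.v *)
(* In the scale of g, a section of S^2 TM(-2) becomes a symmetric tensor t_bc and
   metrisability reads nabla_a t_bc = - g_ab w_c - g_ac w_b, with w the lowered mu.
   Tracing, w = df for f = -1/2 tr t.  The Ricci identity for t, contracted with a
   nullity vector v (whose curvature contractions are those of constant curvature
   B, in the second slot by definition and in the last slot by the pair symmetry
   of the Riemann tensor), shows that K = nabla w - B t satisfies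
   v_b K_dc + K_db v_c = g_db K(v)_c + g_dc K(v)_b, so K = k g for a function k.
   The Ricci identity for w, contracted with v, then gives dk = - 2 B w since
   n >= 2, and differentiating nabla df = B t + k g yields the
   Gallot-Obata-Tanno equation.  Moreover k = (tr nabla w + 2 B f) / n depends on
   f only, so t is recovered from f, and the same formula turns any solution f
   into a solution t. *)
Require Import Defs.
From HB Require Import structures.
From mathcomp Require Import all_boot all_order all_algebra.
From mathcomp Require Import all_classical all_reals all_analysis.
From mathcomp Require Import perm ring lra.

Set Implicit Arguments.
Unset Strict Implicit.
Unset Printing Implicit Defensive.

Import Order.TTheory GRing.Theory Num.Theory.
Import numFieldNormedType.Exports.

Local Open Scope classical_set_scope.
Local Open Scope ring_scope.

(** * Partial derivatives and closure properties of smooth functions *)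

Section PartialDerivatives.
Context {R : realType} {n : nat}.
Implicit Types (F K : 'rV[R]_n -> R) (U V : set 'rV[R]_n) (u : 'rV[R]_n).

(** The nullity vector v is chosen point by point, with no regularity in the point, so no identity
    containing v may be differentiated. Every contraction with v is therefore an algebraic step at
    one point, and only its outcome, free of v (first K = k g, later dk = -2Bw), is differentiated;
    k is written as a trace, which makes it smooth. Constancy of B removes the dB term from the
    derivative of B t + k g, and B nonzero allows nabla df = B t + k g to be solved for t. On the
    way back, the trace of the Gallot-Obata-Tanno equation fixes the derivative of tr nabla df, and
    this is what makes the trace part of t fit. Sections are families of components over charts. In
    one chart the derivative index is a parameter and the other indices are matrix entries, so
    tensor identities become matrix identities. The weight -2 is removed by a parallel density, a
    power of det g. Gluing needs the Hessian to be a tensor, which rests on the transformation law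
    of the Christoffel symbols; this comes from uniqueness of the Levi-Civita connection. *)

Lemma near_eq_differentiable F K u :
  (\near u, F u = K u) -> differentiable F u -> differentiable K u.
Proof.
move=> FK dF; have FKu := nbhs_singleton FK.
have [cF eF] := (diff_locallyP _ _).1 dF.
suff eK : K \o shift u = cst (K u) + 'd F u +o_ (0 : 'rV[R]_n) id.
  have dKF := diff_unique cF eK.
  by apply/diff_locallyP; rewrite dKF.
apply/eqaddoP => e e0; have /eqaddoP /(_ e e0) := eF.
have FK0 : \forall h \near (0 : 'rV[R]_n), F (h + u) = K (h + u).
  by have := FK; rewrite (near_shift 0) /= subr0.
move=> H; near=> h.
have -> : (K \o shift u - (cst (K u) + 'd F u)) h
          = (F \o shift u - (cst (F u) + 'd F u)) h.
  by rewrite /= !fctE /= -FKu; congr (_ - _); symmetry; near: h.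
by near: h.
Unshelve. all: by end_near. Qed.

Lemma partialE j F u :
  differentiable F u -> partial j F u = 'd F u (delta_mx 0 j).
Proof. by move=> dF; rewrite /partial deriveE. Qed.

Lemma partial_near j F K u :
  (\near u, F u = K u) -> partial j F u = partial j K u.
Proof. exact: near_eq_derive. Qed.

Lemma eq_partial j F K U u :
  open U -> (forall w, U w -> F w = K w) -> U u -> partial j F u = partial j K u.
Proof.
move=> oU FK Uu; apply: partial_near.
by near=> w; apply: FK; near: w; exact: open_nbhs_nbhs.
Unshelve. all: by end_near. Qed.

Lemma eq_differentiable F K U u :
  open U -> (forall w, U w -> F w = K w) -> U u ->
  differentiable F u -> differentiable K u.
Proof.
move=> oU FK Uu; apply: near_eq_differentiable.
by near=> w; apply: FK; near: w; exact: open_nbhs_nbhs.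
Unshelve. all: by end_near. Qed.

Lemma partial_cst j (a : R) u : partial j (fun=> a) u = 0.
Proof. exact: derive_cst. Qed.

Lemma partialD j F K u : differentiable F u -> differentiable K u ->
  partial j (fun w => F w + K w) u = partial j F u + partial j K u.
Proof. by move=> dF dK; apply: deriveD; exact: diff_derivable. Qed.

Lemma partialM j F K u : differentiable F u -> differentiable K u ->
  partial j (fun w => F w * K w) u = F u * partial j K u + K u * partial j F u.
Proof. by move=> dF dK; apply: deriveM; exact: diff_derivable. Qed.

Lemma partialV j F u : F u != 0 -> differentiable F u ->
  partial j (fun w => (F w)^-1) u = - (F u) ^- 2 * partial j F u.
Proof. by move=> F0 dF; apply: deriveV => //; exact: diff_derivable. Qed.

Lemma differentiable_powR F p u : 0 < F u -> differentiable F u ->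
  differentiable (fun w => F w `^ p) u.
Proof.
move=> F0 dF; apply: (@differentiable_comp _ _ _ _ F (fun x => x `^ p)) => //.
apply/derivable1_diffP; exact: (@ex_derive _ _ _ _ _ _ _ (is_derive1_powR p F0)).
Qed.

Lemma partial_powR j F p u : 0 < F u -> differentiable F u ->
  partial j (fun w => F w `^ p) u = p * F u `^ (p - 1) * partial j F u.
Proof.
move=> F0 dF; have dp := is_derive1_powR p F0.
have dpF : differentiable (fun x : R => x `^ p) (F u).
  by apply/derivable1_diffP; exact: ex_derive.
rewrite partialE; last exact: differentiable_powR.
rewrite (@diff_comp _ _ _ _ F (fun x : R => x `^ p)) //= -partialE //.
rewrite -[partial j F u]mulr1 [LHS]linearZ /= -deriveE // mulrC mulr1.
by congr (_ * _); exact: derive_val.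
Qed.

Lemma differentiable_sumf (I : Type) (r : seq I) (P : pred I)
    (F : I -> 'rV[R]_n -> R) u :
  (forall i, differentiable (F i) u) ->
  differentiable (fun w => \sum_(i <- r | P i) F i w) u.
Proof.
move=> dF; rewrite (_ : (fun w => _) = \sum_(i <- r | P i) F i); last first.
  by apply/funext => w; rewrite fct_sumE.
by elim/big_ind : _ => // ? ? g h; exact: differentiableD.
Qed.

Lemma partial_sum j (I : Type) (r : seq I) (P : pred I)
    (F : I -> 'rV[R]_n -> R) u :
  (forall i, differentiable (F i) u) ->
  partial j (fun w => \sum_(i <- r | P i) F i w) u
  = \sum_(i <- r | P i) partial j (F i) u.
Proof.
move=> dF; elim: r => [|i r IH].
  rewrite big_nil (_ : (fun w => _) = fun=> 0) ?partial_cst //.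
  by apply/funext => w; rewrite big_nil.
rewrite big_cons (_ : (fun w => _) = fun w =>
  if P i then F i w + \sum_(i <- r | P i) F i w else \sum_(i <- r | P i) F i w);
  last by apply/funext => w; rewrite big_cons.
by case: (P i) => //; rewrite partialD ?IH //; exact: differentiable_sumf.
Qed.

Lemma smooth_diff U F u : smooth_on U F -> U u -> differentiable F u.
Proof. by move=> sF; exact: (sF [::]). Qed.

Lemma smooth_sub U V F : V `<=` U -> smooth_on U F -> smooth_on V F.
Proof. by move=> VU sF s u /VU; exact: sF. Qed.

Lemma smooth_partial j U F : smooth_on U F -> smooth_on U (partial j F).
Proof. by move=> sF s u Uu; have := sF (rcons s j) u Uu; rewrite foldr_rcons. Qed.

(** Iterated partials stay in [P] up to equality on [U]; as [U] is open, such an equality passes to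
    the next derivative. *)
Lemma smooth_coind (P : ('rV[R]_n -> R) -> Prop) U : open U ->
  (forall F u, P F -> U u -> differentiable F u) ->
  (forall j F, P F -> exists2 K, P K & forall u, U u -> partial j F u = K u) ->
  forall F, P F -> smooth_on U F.
Proof.
move=> oU dP pP F PF s.
suff [K PK eK] : exists2 K, P K & forall u, U u -> foldr partial F s u = K u.
  by move=> u Uu; apply: (@eq_differentiable K _ U) => // [w /eK ->//|]; exact: dP.
elim: s => [|j s [K PK eK]] /=; first by exists F.
have [L PL eL] := pP j K PK; exists L => // u Uu.
by rewrite (eq_partial j oU eK Uu) eL.
Qed.

(** The derivative of a product, inverse or power mixes all these operations again, so they are
    closed off together: this class is stable under [partial] on [U], and [smooth_coind] applies to
    it once. *)
Inductive smooth_gen U : ('rV[R]_n -> R) -> Prop :=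
| gen_smooth F : smooth_on U F -> smooth_gen U F
| gen_cst a : smooth_gen U (fun=> a)
| gen_add F K : smooth_gen U F -> smooth_gen U K ->
    smooth_gen U (fun w => F w + K w)
| gen_mul F K : smooth_gen U F -> smooth_gen U K ->
    smooth_gen U (fun w => F w * K w)
| gen_inv F : (forall u, U u -> F u != 0) -> smooth_gen U F ->
    smooth_gen U (fun w => (F w)^-1)
| gen_powR F p : (forall u, U u -> 0 < F u) -> smooth_gen U F ->
    smooth_gen U (fun w => F w `^ p).

Lemma smooth_gen_smooth U F : open U -> smooth_gen U F -> smooth_on U F.
Proof.
move=> oU; have dG K u : smooth_gen U K -> U u -> differentiable K u.
  move=> gK Uu; elim: gK => {K} [K sK|a|K L _ IK _ IL|K L _ IK _ IL|K K0 _ IK|K p K0 _ IK].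
  - exact: smooth_diff sK Uu.
  - exact: differentiable_cst.
  - exact: differentiableD.
  - exact: differentiableM.
  - by apply: differentiableV => //; exact: K0.
  - by apply: differentiable_powR => //; exact: K0.
apply: (smooth_coind oU dG) => j {}F.
elim=> {F} [K sK|a|K L gK [K' gK' eK] gL [L' gL' eL]
  |K L gK [K' gK' eK] gL [L' gL' eL]|K K0 gK [K' gK' eK]|K p K0 gK [K' gK' eK]].
- by exists (partial j K) => //; apply: gen_smooth; exact: smooth_partial.
- by exists (fun=> 0); [exact: gen_cst|move=> u _; exact: partial_cst].
- exists (fun w => K' w + L' w); first exact: gen_add.
  by move=> u Uu; rewrite partialD ?eK ?eL //; exact: dG.
- exists (fun w => K w * L' w + L w * K' w); first by apply: gen_add; exact: gen_mul.
  by move=> u Uu; rewrite partialM ?eK ?eL //; exact: dG.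
- exists (fun w => ((-1) * ((K w)^-1 * (K w)^-1)) * K' w).
    apply: gen_mul => //; apply: gen_mul; first exact: gen_cst.
    by apply: gen_mul; exact: gen_inv.
  move=> u Uu; rewrite partialV ?eK //; [|exact: K0|exact: dG].
  by rewrite -exprVn expr2 mulN1r.
- exists (fun w => (p * K w `^ (p - 1)) * K' w).
    apply: gen_mul => //; apply: gen_mul; first exact: gen_cst.
    exact: gen_powR.
  by move=> u Uu; rewrite partial_powR ?eK //; [exact: K0|exact: dG].
Qed.

Section SmoothClosure.
Context (U : set 'rV[R]_n) (oU : open U).

Lemma smooth_cst (a : R) : smooth_on U (fun=> a).
Proof. by apply: smooth_gen_smooth => //; exact: gen_cst. Qed.

Lemma smoothD F K : smooth_on U F -> smooth_on U K ->
  smooth_on U (fun w => F w + K w).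
Proof.
by move=> sF sK; apply: smooth_gen_smooth => //; apply: gen_add; exact: gen_smooth.
Qed.

Lemma smoothM F K : smooth_on U F -> smooth_on U K ->
  smooth_on U (fun w => F w * K w).
Proof.
by move=> sF sK; apply: smooth_gen_smooth => //; apply: gen_mul; exact: gen_smooth.
Qed.

Lemma smoothN F : smooth_on U F -> smooth_on U (fun w => - F w).
Proof.
move=> sF; rewrite (_ : (fun w => _) = fun w => (-1) * F w).
  by apply: smoothM => //; exact: smooth_cst.
by apply/funext => w; rewrite mulN1r.
Qed.

Lemma smoothV F : (forall u, U u -> F u != 0) -> smooth_on U F ->
  smooth_on U (fun w => (F w)^-1).
Proof.
by move=> F0 sF; apply: smooth_gen_smooth => //; apply: gen_inv => //; exact: gen_smooth.
Qed.

Lemma smooth_powR F p : (forall u, U u -> 0 < F u) -> smooth_on U F ->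
  smooth_on U (fun w => F w `^ p).
Proof.
by move=> F0 sF; apply: smooth_gen_smooth => //; apply: gen_powR => //; exact: gen_smooth.
Qed.

Lemma smooth_sum (I : Type) (r : seq I) (P : pred I) (F : I -> 'rV[R]_n -> R) :
  (forall i, smooth_on U (F i)) ->
  smooth_on U (fun w => \sum_(i <- r | P i) F i w).
Proof.
move=> sF; elim: r => [|i r IH].
  rewrite (_ : (fun w => _) = fun=> 0); first exact: smooth_cst.
  by apply/funext => w; rewrite big_nil.
rewrite (_ : (fun w => _) = fun w =>
  if P i then F i w + \sum_(i <- r | P i) F i w else \sum_(i <- r | P i) F i w);
  last by apply/funext => w; rewrite big_cons.
by case: (P i) => //; exact: smoothD.
Qed.

Lemma smooth_prod (I : Type) (r : seq I) (P : pred I) (F : I -> 'rV[R]_n -> R) :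
  (forall i, smooth_on U (F i)) ->
  smooth_on U (fun w => \prod_(i <- r | P i) F i w).
Proof.
move=> sF; elim: r => [|i r IH].
  rewrite (_ : (fun w => _) = fun=> 1); first exact: smooth_cst.
  by apply/funext => w; rewrite big_nil.
rewrite (_ : (fun w => _) = fun w =>
  if P i then F i w * \prod_(i <- r | P i) F i w else \prod_(i <- r | P i) F i w);
  last by apply/funext => w; rewrite big_cons.
by case: (P i) => //; exact: smoothM.
Qed.

Lemma eq_smooth F K : (forall u, U u -> F u = K u) -> smooth_on U F -> smooth_on U K.
Proof.
move=> FK sF s u Uu; apply: (@eq_differentiable (foldr partial F s) _ U) => //.
  elim: s => [//|j s IH] w Uw /=; exact: (eq_partial j oU IH Uw).
exact: sF.
Qed.

End SmoothClosure.
End PartialDerivatives.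

(* Locked, as conversion would otherwise unfold derivatives down to limits. *)
HB.lock Definition mpart (R : realType) (n p q : nat) (a : 'I_n)
    (A : 'rV[R]_n -> 'M[R]_(p, q)) (u : 'rV[R]_n) : 'M[R]_(p, q) :=
  \matrix_(i, j) partial a (fun w => A w i j) u.
Arguments mpart {R n p q}.

Lemma mpartE (R : realType) (n p q : nat) a (A : 'rV[R]_n -> 'M[R]_(p, q)) u i j :
  mpart a A u i j = partial a (fun w => A w i j) u.
Proof. by rewrite mpart.unlock mxE. Qed.

(** * Symmetry of second derivatives, chain rule, derivative of a determinant *)

Section SecondOrder.
Context {R : realType} {n : nat}.
Implicit Types (F : 'rV[R]_n -> R) (U : set 'rV[R]_n) (u : 'rV[R]_n).

Lemma open_line U u (v w : 'rV[R]_n) : open U -> U u ->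
  exists2 d : R, 0 < d & forall s t, `|s| < d -> `|t| < d -> U (u + s *: v + t *: w).
Proof.
move=> oU Uu; have /nbhs_ballP[e /= e0 eU] := open_nbhs_nbhs (conj oU Uu).
have N0 : 0 < `|v| + `|w| + 1 by rewrite ltr_wpDl // addr_ge0.
exists (e / (`|v| + `|w| + 1)); first exact: divr_gt0.
move=> s t sd td; apply: eU; rewrite -ball_normE /ball_ /=.
rewrite -addrA opprD addrA subrr add0r normrN.
apply: le_lt_trans (ler_normD _ _) _; rewrite !normrZ.
have M : `|s| * `|v| + `|t| * `|w| <= e / (`|v| + `|w| + 1) * (`|v| + `|w|).
  by rewrite mulrDr lerD // ler_wpM2r // ltW.
apply: le_lt_trans M _; rewrite mulrAC ltr_pdivrMr // ltr_pM2l //.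
by rewrite ltrDl.
Qed.

Lemma is_derive_line F (x v : 'rV[R]_n) (t : R) :
  differentiable F (x + t *: v) ->
  is_derive t (1 : R) (fun s : R => F (x + s *: v)) ('D_v F (x + t *: v)).
Proof.
move=> dF; have dl : is_diff t (fun s : R => x + s *: v) ( *:%R^~ v).
  rewrite -[X in is_diff _ _ X]add0r; exact: is_diffD.
have dd : differentiable (fun s : R => x + s *: v) t by case: dl.
have -> : (fun s : R => F (x + s *: v)) = F \o (fun s => x + s *: v) by [].
have d1 : differentiable (F \o (fun s : R => x + s *: v)) t.
  exact: differentiable_comp.
apply: DeriveDef; first exact: diff_derivable.
rewrite deriveE // diff_comp // ?deriveE //=.
by rewrite diff_val scale1r.
Qed.

(* Young's argument: by the mean value theorem applied to
   t |-> F (u + t v + h w) - F (u + t v), the symmetric second difference over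
   h^2 tends to 'D_w ('D_v F) u as soon as 'D_v F is differentiable at u. *)
Lemma second_difference F U u (v w : 'rV[R]_n) : open U -> U u ->
  (forall x, U x -> differentiable F x) -> differentiable ('D_v F) u ->
  forall e, 0 < e -> exists2 d, 0 < d & forall h, 0 < h < d ->
    `|(F (u + h *: v + h *: w) - F (u + h *: v) - F (u + h *: w) + F u)
      - h ^+ 2 * 'D_w ('D_v F) u| <= e * h ^+ 2.
Proof.
move=> oU Uu dF dDF e e0.
have [d1 d10 lineU] := open_line v w oU Uu.
have [cD eD] := (diff_locallyP _ _).1 dDF.
(* The two remainders below have arguments of norm at most h|v| and h(|v| + |w|), of total at most
   hN; the 1 keeps N positive. *)
pose N := 2 * `|v| + `|w| + 1.
have N0 : 0 < N by rewrite ltr_wpDl // addr_ge0 // mulr_ge0.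
have eN0 : 0 < e / N by exact: divr_gt0.
have /eqaddoP /(_ _ eN0) /nbhs_ballP[d2 /= d20 Hd2] := eD.
exists (Num.min d1 (d2 / N)); first by rewrite lt_min d10 divr_gt0.
move=> h /andP[h0]; rewrite lt_min => /andP[hd1 hd2].
pose phi t := F (u + h *: w + t *: v) - F (u + t *: v).
pose dphi t := 'D_v F (u + h *: w + t *: v) - 'D_v F (u + t *: v).
have nh : `|h| < d1 by rewrite gtr0_norm.
have phi_d t : t \in `[0, h]%R -> is_derive t (1 : R) phi (dphi t).
  rewrite in_itv /= => /andP[t0 th].
  have nt : `|t| < d1 by rewrite ger0_norm // (le_lt_trans th).
  apply: is_deriveB.
    by apply: is_derive_line; apply: dF; rewrite addrAC; exact: lineU.
  apply: is_derive_line; apply: dF.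
  by have := lineU t 0 nt; rewrite normr0 scale0r addr0; apply.
have phi_c : {within `[0, h], continuous phi}.
  by apply: derivable_within_continuous => t /phi_d[].
have [c /[!in_itv]/= /andP[c0 ch] Ec] := MVT h0
  (fun t th => phi_d t (subset_itv_oo_cc th)) phi_c.
have -> : F (u + h *: v + h *: w) - F (u + h *: v) - F (u + h *: w) + F u
          = phi h - phi 0.
  rewrite /phi !scale0r !addr0 [u + h *: w + _]addrAC; ring.
rewrite Ec subr0.
pose r x := 'D_v F (x + u) - ('D_v F u + 'd ('D_v F) u x).
have rb x : `|x| < d2 -> `|r x| <= e / N * `|x|.
  move=> xd; apply: Hd2; by rewrite -ball_normE /ball_ /= sub0r normrN.
have hE : dphi c = h * 'D_w ('D_v F) u
    + (r (h *: w + c *: v) - r (c *: v)).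
  rewrite /dphi /r [X in 'D_v F X](_ : _ = h *: w + c *: v + u); last first.
    by rewrite [RHS]addrC addrA.
  rewrite [u + c *: v]addrC; have -> : 'D_w ('D_v F) u = 'd ('D_v F) u w.
    exact: deriveE.
  have -> : 'd ('D_v F) u (h *: w + c *: v)
      = h * 'd ('D_v F) u w + 'd ('D_v F) u (c *: v).
    by rewrite linearD linearZ.
  set a1 := 'D_v F _; set a2 := 'D_v F _; set a3 := 'd _ _ _.
  set a4 := 'd _ _ _; set a5 := 'D_v F _.
  ring.
have nc : `|c *: v| <= h * `|v|.
  by rewrite normrZ gtr0_norm // ler_wpM2r // ltW.
have nw : `|h *: w + c *: v| <= h * (`|w| + `|v|).
  rewrite mulrDr (le_trans (ler_normD _ _)) // lerD //.
  by rewrite normrZ gtr0_norm.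
have hN : h * N < d2 by rewrite -ltr_pdivlMr.
have lt1 : `|c *: v| < d2.
  apply: le_lt_trans nc (le_lt_trans _ hN); rewrite ler_pM2l // /N.
  have := normr_ge0 v; have := normr_ge0 w; lra.
have lt2 : `|h *: w + c *: v| < d2.
  apply: le_lt_trans nw (le_lt_trans _ hN); rewrite ler_pM2l // /N.
  have := normr_ge0 v; lra.
have -> : dphi c * h - h ^+ 2 * 'D_w ('D_v F) u
          = h * (r (h *: w + c *: v) - r (c *: v)) by rewrite hE; ring.
rewrite normrM gtr0_norm // expr2 [e * _]mulrCA ler_pM2l //.
apply: le_trans (ler_normB _ _) _.
apply: le_trans (lerD (rb _ lt2) (rb _ lt1)) _.
rewrite -mulrDr -mulrA ler_pM2l // ler_pdivrMl // mulrC.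
apply: le_trans (lerD nw nc) _; rewrite -mulrDr ler_pM2l // /N; lra.
Qed.

(** The second difference is symmetric in v and w, so for small h it is close to h^2 times either
    mixed derivative; the two then differ by at most any e > 0. *)
Lemma partial_comm U F i j u : open U -> smooth_on U F -> U u ->
  partial i (partial j F) u = partial j (partial i F) u.
Proof.
move=> oU sF Uu; pose v : 'rV[R]_n := delta_mx 0 j.
pose w : 'rV[R]_n := delta_mx 0 i.
have dF x : U x -> differentiable F x by exact: smooth_diff.
have dv : differentiable ('D_v F) u by exact: (smooth_diff (smooth_partial j sF) Uu).
have dw : differentiable ('D_w F) u by exact: (smooth_diff (smooth_partial i sF) Uu).
apply/eqP; rewrite -subr_eq0 -normr_le0; apply/ler_addgt0Pl => e e0; rewrite addr0.
have e20 : 0 < e / 2 by rewrite divr_gt0.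
have [d1 d10 H1] := second_difference w oU Uu dF dv e20.
have [d2 d20 H2] := second_difference v oU Uu dF dw e20.
pose h := Num.min d1 d2 / 2.
have m0 : 0 < Num.min d1 d2 by rewrite lt_min d10.
have h0 : 0 < h by rewrite divr_gt0.
have hm : h < Num.min d1 d2 by rewrite ltr_pdivrMr // mulr_natr mulr2n ltrDl.
have := hm; rewrite lt_min => /andP[hd1 hd2].
have := H1 h; rewrite h0 hd1 => /(_ isT); have := H2 h; rewrite h0 hd2 => /(_ isT).
rewrite [u + h *: w + h *: v]addrAC.
set S := F (_ + _ + _); set a := F _; set b := F (_ + _); set c := F _.
rewrite -/(partial j ('D_w F) u) -/(partial i ('D_v F) u).
rewrite -/(partial j F) -/(partial i F).
set p := partial j _ _; set q := partial i _ _ => A1 A2.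
have h20 : 0 < h ^+ 2 by rewrite exprn_gt0.
rewrite -(ler_pM2l h20) -[X in X * `|_|](gtr0_norm h20) -normrM.
rewrite (_ : h ^+ 2 * (q - p) = (S - a - b + c - h ^+ 2 * p)
  - (S - b - a + c - h ^+ 2 * q)); last by ring.
apply: le_trans (ler_normB _ _) _; rewrite (le_trans (lerD A1 A2)) //.
by rewrite -mulrDl -splitr mulrC.
Qed.

Lemma partial_comp {m : nat} (t : 'rV[R]_n -> 'rV[R]_m) (F : 'rV[R]_m -> R) a u :
  (forall p, differentiable (fun w => t w 0 p) u) -> differentiable F (t u) ->
  partial a (F \o t) u = \sum_p partial p F (t u) * partial a (fun w => t w 0 p) u.
Proof.
move=> dt dF.
have te : t = \sum_p (fun w => t w 0 p *: delta_mx 0 p).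
  by apply/funext => w; rewrite fct_sumE {1}[t w]row_sum_delta.
have dtu : differentiable t u.
  rewrite te; apply: differentiable_sum => p; exact: differentiableZl.
rewrite partialE; last exact: differentiable_comp.
rewrite diff_comp //= -[X in 'd F _ X]deriveE //.
rewrite derive_mx; last exact: diff_derivable.
rewrite [X in 'd F _ X](row_sum_delta) linear_sum; apply: eq_bigr => p _.
by rewrite linearZ /= mxE partialE // mulrC.
Qed.

Lemma partial_prod j (I : eqType) (r : seq I) (F : I -> 'rV[R]_n -> R) u :
  uniq r -> (forall i, differentiable (F i) u) ->
  differentiable (fun w => \prod_(i <- r) F i w) u /\
  partial j (fun w => \prod_(i <- r) F i w) u
  = \sum_(i <- r) partial j (F i) u * \prod_(k <- r | k != i) F k u.
Proof.
move=> + dF; elim: r => [_|i r IH /= /andP[ir /IH[dr pr]]].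
  rewrite big_nil (_ : (fun w => _) = fun=> 1) ?partial_cst //.
  by apply/funext => w; rewrite big_nil.
rewrite (_ : (fun w => _) = fun w => F i w * \prod_(i <- r) F i w); last first.
  by apply/funext => w; rewrite big_cons.
split; first exact: differentiableM.
rewrite partialM // pr big_cons big_cons eqxx /= addrC; congr (_ + _).
  rewrite mulrC; congr (_ * _); rewrite [LHS]big_seq [RHS]big_seq_cond.
  by apply: eq_bigl => k; case: eqVneq => [->|]; rewrite ?(negPf ir) ?andbT.
rewrite mulr_sumr; apply: eq_big_seq => k kr.
have ik : i != k by apply: contraNneq ir => ->.
by rewrite big_cons ik mulrCA.
Qed.

(** Jacobi's formula: the product rule in the Leibniz expansion differentiates one row at a time,
    and expansion along that row produces the adjugate. *)
Lemma partial_det (A : 'rV[R]_n -> 'M[R]_n) a u :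
  (forall i j, differentiable (fun w => A w i j) u) ->
  partial a (fun w => \det (A w)) u = \tr (\adj (A u) *m mpart a A u).
Proof.
move=> dA; have dp (s : {perm 'I_n}) := @partial_prod a _ _
  (fun i w => A w i (s i)) u (index_enum_uniq _) (fun i => dA i (s i)).
rewrite /determinant partial_sum; last first.
  move=> s; apply: differentiableM; first exact: differentiable_cst.
  by have [] := dp s.
transitivity (\sum_(s : {perm 'I_n}) \sum_i (-1) ^+ s *
    (mpart a A u i (s i) * \prod_(k | k != i) A u k (s k))).
  apply: eq_bigr => s _; have [d1 e1] := dp s.
  rewrite (partialM a (differentiable_cst _ _) d1).
  rewrite partial_cst mulr0 addr0 e1 mulr_sumr; apply: eq_bigr => i _.
  by rewrite mpartE.
rewrite exchange_big /= /mxtrace.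
under [RHS]eq_bigr do rewrite mxE.
rewrite [RHS]exchange_big /=; apply: eq_bigr => i _.
(* [A u] with row i replaced by its derivative; the cofactors along row i are still those of
   [A u]. *)
pose A' : 'M[R]_n := \matrix_(k, l) if k == i then mpart a A u i l else A u k l.
transitivity (\det A').
  apply: eq_bigr => s _; congr (_ * _); rewrite [RHS](bigD1 i) //= [A' _ _]mxE eqxx.
  by congr (_ * _); apply: eq_bigr => k /negPf ki; rewrite [A' _ _]mxE ki.
rewrite (expand_det_row _ i); apply: eq_bigr => j _.
rewrite [A' _ _]mxE eqxx mulrC [\adj _ _ _]mxE; congr (_ * _).
rewrite /cofactor; congr (_ * \det _); apply/matrixP => k l; rewrite !mxE.
by rewrite eq_sym (negPf (neq_lift _ _)).
Qed.

End SecondOrder.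

(** * Matrix-valued smooth functions on an open set *)

Section MatrixCalculus.
Context {R : realType} {n : nat}.
Implicit Types (U : set 'rV[R]_n) (u : 'rV[R]_n) (k : 'rV[R]_n -> R).

Definition msmooth {p q} U (A : 'rV[R]_n -> 'M[R]_(p, q)) : Prop :=
  forall i j, smooth_on U (fun w => A w i j).

Section Fixed.
Context (U : set 'rV[R]_n) (oU : open U).

Lemma eq_mpart {p q} a (A B : 'rV[R]_n -> 'M[R]_(p, q)) u :
  (forall w, U w -> A w = B w) -> U u -> mpart a A u = mpart a B u.
Proof.
move=> AB Uu; apply/matrixP => i j; rewrite !mpartE.
by apply: (eq_partial a oU) => // w /AB ->.
Qed.

Lemma eq_msmooth {p q} (A B : 'rV[R]_n -> 'M[R]_(p, q)) :
  (forall w, U w -> A w = B w) -> msmooth U A -> msmooth U B.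
Proof. by move=> AB sA i j; apply: eq_smooth (sA i j) => // w /AB ->. Qed.

Lemma msmooth_mpart {p q} a (A : 'rV[R]_n -> 'M[R]_(p, q)) :
  msmooth U A -> msmooth U (mpart a A).
Proof.
move=> sA i j; apply: eq_smooth (smooth_partial a (sA i j)) => // w _.
by rewrite mpartE.
Qed.

Lemma msmoothM {p q r} (A : 'rV[R]_n -> 'M[R]_(p, q)) (B : 'rV[R]_n -> 'M[R]_(q, r)) :
  msmooth U A -> msmooth U B -> msmooth U (fun w => A w *m B w).
Proof.
move=> sA sB i j.
apply: (eq_smooth oU (F := fun w => \sum_l A w i l * B w l j)).
  by move=> w _; rewrite mxE.
by apply: smooth_sum => // l; exact: smoothM.
Qed.

Lemma msmoothD {p q} (A B : 'rV[R]_n -> 'M[R]_(p, q)) :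
  msmooth U A -> msmooth U B -> msmooth U (fun w => A w + B w).
Proof.
move=> sA sB i j; apply: (eq_smooth oU (F := fun w => A w i j + B w i j)).
  by move=> w _; rewrite mxE.
exact: smoothD.
Qed.

Lemma msmoothZ {p q} k (A : 'rV[R]_n -> 'M[R]_(p, q)) :
  smooth_on U k -> msmooth U A -> msmooth U (fun w => k w *: A w).
Proof.
move=> sk sA i j; apply: (eq_smooth oU (F := fun w => k w * A w i j)).
  by move=> w _; rewrite mxE.
exact: smoothM.
Qed.

Lemma msmoothN {p q} (A : 'rV[R]_n -> 'M[R]_(p, q)) :
  msmooth U A -> msmooth U (fun w => - A w).
Proof.
move=> sA i j; apply: (eq_smooth oU (F := fun w => - A w i j)).
  by move=> w _; rewrite mxE.
exact: smoothN.
Qed.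

Lemma msmooth_tr {p q} (A : 'rV[R]_n -> 'M[R]_(p, q)) :
  msmooth U A -> msmooth U (fun w => (A w)^T).
Proof. by move=> sA i j; apply: eq_smooth (sA j i) => // w _; rewrite mxE. Qed.

Lemma msmooth_row {p q} i (A : 'rV[R]_n -> 'M[R]_(p, q)) :
  msmooth U A -> msmooth U (fun w => row i (A w)).
Proof. by move=> sA l j; apply: eq_smooth (sA i j) => // w _; rewrite mxE. Qed.

Lemma smooth_mxtrace {p} (A : 'rV[R]_n -> 'M[R]_p) :
  msmooth U A -> smooth_on U (fun w => \tr (A w)).
Proof. by move=> sA; apply: smooth_sum. Qed.

Lemma smooth_det {p} (A : 'rV[R]_n -> 'M[R]_p) :
  msmooth U A -> smooth_on U (fun w => \det (A w)).
Proof.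
move=> sA; apply: smooth_sum => // s; apply: smoothM => //; first exact: smooth_cst.
by apply: smooth_prod.
Qed.

Lemma msmooth_invmx {p} (A : 'rV[R]_n -> 'M[R]_p) :
  (forall w, U w -> A w \in unitmx) -> msmooth U A ->
  msmooth U (fun w => invmx (A w)).
Proof.
move=> uA sA; apply: (@eq_msmooth _ _ (fun w => (\det (A w))^-1 *: \adj (A w))).
  by move=> w /uA uw; rewrite /invmx uw.
apply: msmoothZ.
  apply: smoothV => //; last exact: smooth_det.
  by move=> w /uA; rewrite unitmxE unitfE.
move=> i j; apply: (eq_smooth oU (F := fun w => cofactor (A w) j i)).
  by move=> w _; rewrite mxE.
apply: smoothM => //; first exact: smooth_cst.
apply: smooth_det => k l; apply: eq_smooth (sA (lift j k) (lift i l)) => // w _.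
by rewrite !mxE.
Qed.

Lemma mpartM {p q r} a (A : 'rV[R]_n -> 'M[R]_(p, q)) (B : 'rV[R]_n -> 'M[R]_(q, r)) u :
  msmooth U A -> msmooth U B -> U u ->
  mpart a (fun w => A w *m B w) u = mpart a A u *m B u + A u *m mpart a B u.
Proof.
move=> sA sB Uu; have dA i j := smooth_diff (sA i j) Uu.
have dB i j := smooth_diff (sB i j) Uu.
apply/matrixP => i j; rewrite mpartE 3!mxE -big_split /=.
rewrite (eq_partial a oU (K := fun w => \sum_l A w i l * B w l j)) //; last first.
  by move=> w _; rewrite mxE.
rewrite partial_sum; last by move=> l; exact: differentiableM.
by apply: eq_bigr => l _; rewrite partialM // !mpartE addrC; congr (_ + _); exact: mulrC.
Qed.

Lemma mpartD {p q} a (A B : 'rV[R]_n -> 'M[R]_(p, q)) u :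
  msmooth U A -> msmooth U B -> U u ->
  mpart a (fun w => A w + B w) u = mpart a A u + mpart a B u.
Proof.
move=> sA sB Uu; have dA i j := smooth_diff (sA i j) Uu.
have dB i j := smooth_diff (sB i j) Uu.
apply/matrixP => i j; rewrite mpartE mxE !mpartE -partialD //.
by apply: (eq_partial a oU) => // w _; rewrite mxE.
Qed.

Lemma mpartZ {p q} a k (A : 'rV[R]_n -> 'M[R]_(p, q)) u :
  smooth_on U k -> msmooth U A -> U u ->
  mpart a (fun w => k w *: A w) u = partial a k u *: A u + k u *: mpart a A u.
Proof.
move=> sk sA Uu; have dA i j := smooth_diff (sA i j) Uu.
have dk := smooth_diff sk Uu.
apply/matrixP => i j; rewrite mpartE 3!mxE !mpartE addrC [partial a k u * _]mulrC -partialM //.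
by apply: (eq_partial a oU) => // w _; rewrite mxE.
Qed.

Lemma mpartN {p q} a (A : 'rV[R]_n -> 'M[R]_(p, q)) u :
  msmooth U A -> U u -> mpart a (fun w => - A w) u = - mpart a A u.
Proof.
move=> sA Uu; rewrite (eq_mpart a (B := fun w => (-1 : R) *: A w)) //; last first.
  by move=> w _; rewrite scaleN1r.
by rewrite mpartZ // ?partial_cst ?scale0r ?add0r ?scaleN1r //; exact: smooth_cst.
Qed.

Lemma mpart_comm {p q} a d (A : 'rV[R]_n -> 'M[R]_(p, q)) u :
  msmooth U A -> U u -> mpart d (mpart a A) u = mpart a (mpart d A) u.
Proof.
move=> sA Uu; apply/matrixP => i j; rewrite [LHS]mpartE [RHS]mpartE.
transitivity (partial d (partial a (fun w => A w i j)) u).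
  by apply: (eq_partial d oU) => // w _; rewrite mpartE.
rewrite (partial_comm d a oU (sA i j) Uu).
by apply: (eq_partial a oU) => // w _; rewrite mpartE.
Qed.

Lemma partial_mxtrace {p} a (A : 'rV[R]_n -> 'M[R]_p) u :
  msmooth U A -> U u -> partial a (fun w => \tr (A w)) u = \tr (mpart a A u).
Proof.
move=> sA Uu; rewrite /mxtrace partial_sum; last first.
  by move=> i; exact: smooth_diff (sA i i) Uu.
by apply: eq_bigr => i _; rewrite mpartE.
Qed.

End Fixed.

Lemma mpart_tr {p q} a (A : 'rV[R]_n -> 'M[R]_(p, q)) u :
  mpart a (fun w => (A w)^T) u = (mpart a A u)^T.
Proof.
apply/matrixP => i j; rewrite mpartE mxE mpartE; congr (partial a _ u).
by apply/funext => w; rewrite mxE.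
Qed.

Lemma mpart_row {p q} a i (A : 'rV[R]_n -> 'M[R]_(p, q)) u :
  mpart a (fun w => row i (A w)) u = row i (mpart a A u).
Proof.
apply/matrixP => k j; rewrite mpartE mxE mpartE; congr (partial a _ u).
by apply/funext => w; rewrite mxE.
Qed.

Lemma mpart_cst {p q} a (A : 'M[R]_(p, q)) u : mpart a (fun=> A) u = 0.
Proof. by apply/matrixP => i j; rewrite mpartE mxE partial_cst. Qed.

End MatrixCalculus.

Section MatrixIdentities.
Context {R : realType}.

Lemma mxaddE p q (A B : 'M[R]_(p, q)) i j : (A + B) i j = A i j + B i j.
Proof. by rewrite mxE. Qed.

Lemma mxoppE p q (A : 'M[R]_(p, q)) i j : (- A) i j = - A i j.
Proof. by rewrite mxE. Qed.

Lemma mxscaleE p q k (A : 'M[R]_(p, q)) i j : (k *: A) i j = k * A i j.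
Proof. by rewrite mxE. Qed.

Lemma mxtrD p q (A B : 'M[R]_(p, q)) : (A + B)^T = A^T + B^T.
Proof. exact: linearD. Qed.

Lemma mxtrN p q (A : 'M[R]_(p, q)) : (- A)^T = - A^T.
Proof. exact: linearN. Qed.

Lemma mxtrZ p q k (A : 'M[R]_(p, q)) : (k *: A)^T = k *: A^T.
Proof. exact: linearZ. Qed.

End MatrixIdentities.

(* [ring] sees the entries of a product as atoms, so [mxdist] must expand first. *)
Ltac mxdist := rewrite ?(mxtrD, mxtrN, mxtrZ, trmx_mul, trmxK);
  rewrite ?(mulmxDl, mulmxDr, mulNmx, mulmxN, =^~ scalemxAl, =^~ scalemxAr, mulmxA).
Ltac mxentries := let i := fresh in let j := fresh in
  apply/matrixP => i j; rewrite ?(mxaddE, mxoppE, mxscaleE); ring.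

(** The connection matrix in direction [a], with the upper index as row index: a covector, as a row,
    is differentiated covariantly by subtracting its product with [Gam] on the right, and the first
    slot of a bilinear form by subtracting the product with the transpose on the left. *)
HB.lock Definition Gam (R : realType) (n : nat) (G : 'rV[R]_n -> 'M[R]_n)
    (a : 'I_n) (u : 'rV[R]_n) : 'M[R]_n :=
  \matrix_(i, j) christoffel G i a j u.
Arguments Gam {R n}.

Lemma GamE (R : realType) (n : nat) (G : 'rV[R]_n -> 'M[R]_n) a u i j :
  Gam G a u i j = christoffel G i a j u.
Proof. by rewrite Gam.unlock mxE. Qed.

(** * Levi-Civita connection and metric density in one chart *)

Section ChartGeometry.
Context {R : realType} {n : nat} (G : 'rV[R]_n -> 'M[R]_n) (U : set 'rV[R]_n).
Implicit Types (u w : 'rV[R]_n) (a b c d i j k l : 'I_n).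

Definition Rmat d a u : 'M[R]_n := \matrix_(i, j) riemann G i j d a u.

Definition cov (H : 'rV[R]_n -> 'M[R]_n) a u : 'M[R]_n :=
  mpart a H u - (Gam G a u)^T *m H u - H u *m Gam G a u.

(** The derivative index is the row index, so rows are the covectors nabla_d om. *)
Definition covf (om : 'rV[R]_n -> 'rV[R]_n) u : 'M[R]_n :=
  \matrix_d (mpart d om u - om u *m Gam G d u).

Lemma nabla_form2E (H : 'rV[R]_n -> 'M[R]_n) a b c u :
  nabla_form2 G (fun b c w => H w b c) a b c u = cov H a u b c.
Proof.
rewrite /nabla_form2 /cov 4!mxE mpartE 2!mxE; congr (_ - _ - _); apply: eq_bigr => k _.
  by rewrite mxE GamE.
by rewrite GamE mulrC.
Qed.

Lemma nabla_formE (om : 'rV[R]_n -> 'rV[R]_n) d c u :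
  nabla_form G (fun c w => om w 0 c) d c u = covf om u d c.
Proof.
rewrite /nabla_form /covf 3!mxE mpartE mxE; congr (_ - _); apply: eq_bigr => k _.
by rewrite GamE mulrC.
Qed.

Lemma row_covf om d u : row d (covf om u) = mpart d om u - om u *m Gam G d u.
Proof. by rewrite /covf rowK. Qed.

Context (oU : open U) (sG : msmooth U G)
  (symG : forall u, U u -> (G u)^T = G u) (unitG : forall u, U u -> G u \in unitmx).

Let sGi : msmooth U (fun w => invmx (G w)).
Proof. exact: msmooth_invmx. Qed.

Lemma msmooth_Gam a : msmooth U (Gam G a).
Proof.
move=> i j; apply: (eq_smooth oU (F := christoffel G i a j)).
  by move=> w _; rewrite GamE.
apply: smoothM => //; first exact: smooth_cst.
apply: smooth_sum => // l; apply: smoothM => //.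
apply: smoothD => //; last by apply: smoothN => //; exact: smooth_partial.
by apply: smoothD => //; exact: smooth_partial.
Qed.

Lemma partial_G_sym a i j u : U u ->
  partial a (fun w => G w i j) u = partial a (fun w => G w j i) u.
Proof.
move=> Uu; apply: (eq_partial a oU _ Uu) => w /symG Gw.
by rewrite -[in LHS]Gw mxE.
Qed.

Lemma christoffelC i j k u : U u -> christoffel G i j k u = christoffel G i k j u.
Proof.
move=> Uu; congr (_ * _); apply: eq_bigr => l _; congr (_ * _).
by rewrite [partial j _ u + _]addrC (partial_G_sym l j k Uu).
Qed.

Lemma row_Gam_sym a d u : U u -> row a (Gam G d u)^T = row d (Gam G a u)^T.
Proof. by move=> Uu; apply/matrixP => i j; rewrite !mxE !GamE christoffelC. Qed.

(** Christoffel symbols of the first kind: lowering cancels the inverse metric, and metric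
    compatibility becomes linear in the derivatives of [G]. *)
Lemma mulG_Gam a i j u : U u -> (G u *m Gam G a u) i j =
  2^-1 * (partial a (fun w => G w i j) u + partial j (fun w => G w i a) u
          - partial i (fun w => G w a j) u).
Proof.
move=> Uu; pose V : 'cV[R]_n := \col_l (partial a (fun w => G w l j) u
  + partial j (fun w => G w l a) u - partial l (fun w => G w a j) u).
have -> : (G u *m Gam G a u) i j = 2^-1 * (G u *m (invmx (G u) *m V)) i 0.
  rewrite !mxE mulr_sumr; apply: eq_bigr => k _; rewrite GamE mxE /christoffel.
  rewrite mulrCA; congr (_ * (_ * _)); apply: eq_bigr => l _.
  by rewrite mxE.
by rewrite mulmxA mulmxV ?unitG // mul1mx mxE.
Qed.

Lemma mpart_G a u : U u -> mpart a G u = (Gam G a u)^T *m G u + G u *m Gam G a u.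
Proof.
move=> Uu; have -> : (Gam G a u)^T *m G u = (G u *m Gam G a u)^T.
  by rewrite trmx_mul symG.
apply/matrixP => i j; rewrite mpartE mxaddE [X in _ = X + _]mxE !mulG_Gam //.
rewrite (partial_G_sym a j i Uu) (partial_G_sym i j a Uu) (partial_G_sym j i a Uu).
by field.
Qed.

Lemma cov_G a u : U u -> cov G a u = 0.
Proof. by move=> Uu; rewrite /cov mpart_G // addrAC addrK subrr. Qed.

Lemma mpart_invG a u : U u -> mpart a (fun w => invmx (G w)) u =
  - (invmx (G u) *m (Gam G a u)^T + Gam G a u *m invmx (G u)).
Proof.
move=> Uu; have : mpart a (fun w => invmx (G w) *m G w) u = 0.
  rewrite (eq_mpart oU a (B := fun=> 1%:M)) ?mpart_cst // => w Uw.
  by rewrite mulVmx ?unitG.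
rewrite (mpartM oU) // mpart_G // => /(congr1 (mulmxr (invmx (G u)))) /=.
rewrite mul0mx mulmxDl -mulmxA mulmxV ?unitG // mulmx1 => /eqP.
rewrite addr_eq0 => /eqP ->; congr (- _).
by rewrite mulmxDr mulmxDl -!mulmxA mulmxV ?unitG // mulmx1 !mulmxA mulVmx ?unitG // mul1mx.
Qed.

(** The metric is parallel: the connection terms from the derivative of [invmx G] are those that
    complete [mpart a H] to [cov G H a] under the trace. *)
Lemma partial_trace H a u : msmooth U H -> U u ->
  partial a (fun w => \tr (invmx (G w) *m H w)) u = \tr (invmx (G u) *m cov H a u).
Proof.
move=> sH Uu; rewrite (partial_mxtrace _ _ Uu); last exact: msmoothM.
rewrite (mpartM oU) // mpart_invG // /cov.
rewrite !mulmxDr !mulmxN mulNmx mulmxDl !mxtraceD !raddfN /= !mxtraceD.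
rewrite -[Gam G a u *m _ *m _]mulmxA [\tr (Gam G a u *m _)]mxtrace_mulC.
rewrite -!mulmxA; ring.
Qed.

Lemma trace_Gam a u : U u ->
  2 * \tr (Gam G a u) = \tr (invmx (G u) *m mpart a G u).
Proof.
move=> Uu; rewrite mpart_G // mulmxDr mxtraceD mxtrace_mulC -mulmxA mulmxV ?unitG //.
by rewrite mulmx1 mxtrace_tr mulmxA mulVmx ?unitG // mul1mx mulr2n mulrDl mul1r.
Qed.

(* |det G|^(1/(n+1)), the density of weight -2 by which g trivialises E(-2). *)
Definition dens u : R := (\det (G u) ^+ 2) `^ (2 * n.+1%:R)^-1.

Lemma det2_gt0 u : U u -> 0 < \det (G u) ^+ 2.
Proof.
by move=> /unitG; rewrite unitmxE unitfE => d0; rewrite lt0r sqrf_eq0 d0 sqr_ge0.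
Qed.

Lemma dens_gt0 u : U u -> 0 < dens u.
Proof. by move=> Uu; apply: powR_gt0; exact: det2_gt0. Qed.

Lemma smooth_dens : smooth_on U dens.
Proof.
apply: smooth_powR => //; first exact: det2_gt0.
by apply: (smoothM oU); exact: smooth_det.
Qed.

(** In other words [dens] is parallel for the connection on E(-2): the factor 2/(n+1) is the one
    subtracted in [nabla_bivector_m2]. It comes from Jacobi's formula and [trace_Gam]. *)
Lemma partial_dens a u : U u ->
  partial a dens u = 2 / n.+1%:R * \tr (Gam G a u) * dens u.
Proof.
move=> Uu; have dd : differentiable (fun w => \det (G w)) u.
  by have := smooth_diff (smooth_det oU sG) Uu.
have D0 := det2_gt0 Uu.
rewrite /dens (partial_powR a _ D0); last exact: differentiableM.
rewrite (partialM a dd dd) partial_det; last by move=> i j; exact: smooth_diff (sG i j) Uu.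
have -> : \adj (G u) = \det (G u) *: invmx (G u).
  by rewrite /invmx unitG // scalerA mulfV ?scale1r // -unitfE -unitmxE unitG.
rewrite -scalemxAl mxtraceZ -trace_Gam //.
(* Splitting off one factor leaves a single power, which [field] can treat as an atom. *)
have e1 (D p : R) : 0 < D -> D `^ p = D `^ (p - 1) * D.
  by move=> Dp; rewrite -{3}[D]powRr1 ?ltW // -powRD ?subrK // (gt_eqF Dp) implybT.
rewrite [in RHS]e1 //; set X := _ `^ _; have n0 : n.+1%:R != 0 :> R by rewrite pnatr_eq0.
move: n0; set N := n.+1%:R => n0; by field.
Qed.

End ChartGeometry.

(** * Linear algebra at one point *)

Section PointwiseAlgebra.
Context {R : realType}.

(** The four cyclic identities with (i, j, k, l) rotated combine linearly once antisymmetry has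
    normalised their terms. *)
Lemma pair_symmetry (T : Type) (r : T -> T -> T -> T -> R) :
  (forall i j k l, r j i k l = - r i j k l) ->
  (forall i j k l, r i j l k = - r i j k l) ->
  (forall i j k l, r i j k l + r i k l j + r i l j k = 0) ->
  forall i j k l, r i j k l = r k l i j.
Proof.
move=> a12 a34 bi i j k l.
have := bi i j k l; have := bi j k l i; have := bi k l i j; have := bi l i j k.
rewrite (a12 k l i j) (a12 i j k l) (a12 j k l i) (a12 i l j k).
rewrite (a12 i k j l) (a34 i k l j) (a12 l j i k) (a34 l j k i).
lra.
Qed.

Lemma outerE n (x y : 'rV[R]_n) i j : (x^T *m y) i j = x 0 i * y 0 j.
Proof. by rewrite !mxE big_ord1 !mxE. Qed.

Lemma row_entry n (A : 'M[R]_n) d (i : 'I_1) j : row d A i j = A d j.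
Proof. by rewrite mxE. Qed.

Context {n : nat} (G : 'M[R]_n) (unitG : G \in unitmx) (symG : G^T = G).
Context (v : 'rV[R]_n) (v0 : v != 0).

Let sum_row (A : 'M[R]_n) (x : 'rV[R]_n) : \sum_d x 0 d *: row d A = x *m A.
Proof. by rewrite mulmx_sum_row. Qed.

Let vG_neq0 : exists i, (v *m G) 0 i != 0.
Proof.
apply/rV0Pn; apply: contraNneq v0 => vG.
by rewrite -[v]mulmx1 -(mulmxV unitG) mulmxA vG mul0mx.
Qed.

(** With b = vG the hypothesis reads b_i K_dj + K_di b_j = g_di (vK)_j + (vK)_i g_dj. Its trace
    makes v an eigenvector of K relative to g; subtracting that multiple of g leaves a vanishing
    symmetrised product with the nonzero covector b. *)
Lemma sym_pair_proportional (K : 'M[R]_n) :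
  (forall d, (v *m G)^T *m row d K + (row d K)^T *m (v *m G)
             = (row d G)^T *m (v *m K) + (v *m K)^T *m row d G) ->
  K = (n%:R^-1 * \tr (invmx G *m K)) *: G.
Proof.
move=> HK; have n0 : n%:R != 0 :> R.
  rewrite pnatr_eq0; case: (n) v v0 => // x /eqP []; exact: thinmx0.
set t := \tr _.
have vK : v *m K = (n%:R^-1 * t) *: (v *m G).
  suff : t *: (v *m G) = n%:R *: (v *m K).
    by rewrite -scalerA => ->; rewrite scalerA mulVf // scale1r.
  have symI : (invmx G)^T = invmx G by rewrite trmx_inv symG.
  (* Contraction of d with the first matrix index. The four sums [S1] to [S4] give vK + t vG = n vK
     + vK. *)
  have : \sum_d row d (invmx G) *m
      ((v *m G)^T *m row d K + (row d K)^T *m (v *m G)) =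
    \sum_d row d (invmx G) *m
      ((row d G)^T *m (v *m K) + (v *m K)^T *m row d G).
    by apply: eq_bigr => d _; rewrite HK.
  under eq_bigr do rewrite mulmxDr !mulmxA.
  under [RHS]eq_bigr do rewrite mulmxDr !mulmxA.
  rewrite !big_split /=.
  have S1 : \sum_d row d (invmx G) *m (v *m G)^T *m row d K = v *m K.
    rewrite -[RHS]sum_row; apply: eq_bigr => d _.
    rewrite trmx_mul symG -row_mul mulmxA mulVmx // mul1mx.
    by rewrite [X in X *m _]mx11_scalar mul_scalar_mx !mxE.
  have S4 : \sum_d row d (invmx G) *m (v *m K)^T *m row d G = v *m K.
    rewrite -[RHS]mulmx1 -(mulVmx unitG) mulmxA -[RHS]sum_row; apply: eq_bigr => d _.
    rewrite [X in X *m _]mx11_scalar mul_scalar_mx; congr (_ *: _).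
    rewrite -[in RHS]symI -[v *m K]trmxK -trmx_mul trmxK -row_mul.
    by rewrite !mxE.
  have S2 : \sum_d row d (invmx G) *m (row d K)^T *m v *m G = t *: (v *m G).
    rewrite /t -mxtrace_tr trmx_mul symI mxtrace_mulC /mxtrace scaler_suml.
    apply: eq_bigr => d _; rewrite -mulmxA.
    rewrite [X in X *m _ = _]mx11_scalar mul_scalar_mx; congr (_ *: _).
    by rewrite !mxE; apply: eq_bigr => i _; rewrite !mxE.
  have S3 : \sum_d row d (invmx G) *m (row d G)^T *m v *m K = n%:R *: (v *m K).
    have -> : n%:R = \sum_(d < n) 1 :> R by rewrite sumr_const card_ord.
    rewrite scaler_suml; apply: eq_bigr => d _.
    rewrite -mulmxA [X in X *m _ = _]mx11_scalar mul_scalar_mx.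
    congr (_ *: _).
    transitivity ((invmx G *m G^T) d d).
      by rewrite !mxE; apply: eq_bigr => i _; rewrite !mxE.
    by rewrite symG mulVmx // mxE eqxx.
  rewrite S1 S2 S3 S4 addrC => /addIr; exact.
have [i0 bi0] := vG_neq0; move: vK HK; set b := v *m G; move=> vK HK.
pose k := n%:R^-1 * t; rewrite -/k in vK *; pose K' := K - k *: G.
have E d i j : b 0 i * K' d j + K' d i * b 0 j = 0.
  have := congr1 (fun A : 'M[R]_n => A i j) (HK d); rewrite vK !mxaddE !outerE.
  rewrite !mxscaleE !row_entry /K' ?mxaddE !mxoppE !mxscaleE => H.
  lra.
suff : K' = 0 by move=> /eqP; rewrite subr_eq0 => /eqP.
(* At i = j = i0 the relation [E] is twice a product with b_i0 nonzero; at i = i0 it then kills the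
   whole row. *)
have K0 d : K' d i0 = 0.
  have := E d i0 i0; rewrite mulrC -mulr2n -mulr_natl => /eqP.
  by rewrite !mulf_eq0 pnatr_eq0 (negPf bi0) orbF /= => /eqP.
apply/matrixP => d j; rewrite [RHS]mxE; have := E d i0 j.
by rewrite K0 mul0r addr0 => /eqP; rewrite mulf_eq0 (negPf bi0) => /eqP.
Qed.

(** A matrix of rank at most one equals a multiple of the invertible G, so for n at least 2 both
    vanish. Concretely, multiplication by the inverse of G gives xi_d v_d = c for each d, and
    summing over d gives c = n c. *)
Lemma null_covector (xi : 'rV[R]_n) : (1 < n)%N ->
  (forall d, xi 0 d *: (v *m G) = (xi *m v^T) 0 0 *: row d G) -> xi = 0.
Proof.
move=> n1 Hxi; set c := (xi *m v^T) 0 0 in Hxi.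
have E d : xi 0 d * v 0 d = c.
  have := congr1 (fun x => (x *m invmx G) 0 d) (Hxi d).
  rewrite -!scalemxAl -mulmxA mulmxV // mulmx1 -row_mul mulmxV // !mxE eqxx mulr1.
  by [].
have c0 : c = 0.
  have : c = n%:R * c.
    rewrite {1}/c mxE mulr_natl -[n in RHS]card_ord -sumr_const.
    by apply: eq_bigr => d _; rewrite mxE E.
  move/eqP; rewrite -subr_eq0 -[X in X - _]mul1r -mulrBl mulf_eq0 subr_eq0.
  by rewrite eq_sym pnatr_eq1; case: (n) n1 => [//|[//|k _]] /eqP.
have [i0 bi0] := vG_neq0; apply/rowP => d; rewrite [RHS]mxE.
have := congr1 (fun x : 'rV[R]_n => x 0 i0) (Hxi d).
rewrite c0 scale0r mxE [RHS]mxE => /eqP.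
by rewrite mulf_eq0 (negPf bi0) orbF => /eqP.
Qed.

End PointwiseAlgebra.

(** * Curvature identities in one chart *)

Section Curvature.
Context {R : realType} {n : nat} (G : 'rV[R]_n -> 'M[R]_n) (U : set 'rV[R]_n).
Context (oU : open U) (sG : msmooth U G)
  (symG : forall u, U u -> (G u)^T = G u) (unitG : forall u, U u -> G u \in unitmx).
Implicit Types (u w : 'rV[R]_n) (a b c d i j k l : 'I_n).

Let sGam a : msmooth U (Gam G a).
Proof. exact: msmooth_Gam. Qed.

(** The curvature form dA + A A of the connection matrices, the shape in which commuted partial
    derivatives produce it. *)
Lemma RmatE d a u : Rmat G d a u =
  mpart d (Gam G a) u - mpart a (Gam G d) u
  + (Gam G d u *m Gam G a u - Gam G a u *m Gam G d u).
Proof.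
have GE b i j : (fun w => Gam G b w i j) = christoffel G i b j.
  by apply/funext => w; rewrite GamE.
apply/matrixP => i j; rewrite [LHS]mxE !mxaddE !mxoppE !mpartE !GE.
rewrite /riemann; congr (_ + _).
rewrite [X in _ = X - _]mxE [X in _ = _ - X]mxE -sumrB; apply: eq_bigr => m _.
by rewrite !GamE.
Qed.

Lemma Rmat_antisym d a u : Rmat G a d u = - Rmat G d a u.
Proof. by rewrite !RmatE; mxentries. Qed.

Lemma riemann_cyclic i j k l u : U u ->
  riemann G i j k l u + riemann G i k l j u + riemann G i l j k u = 0.
Proof.
move=> Uu; rewrite /riemann.
have pC c e f h : partial c (christoffel G e f h) u = partial c (christoffel G e h f) u.
  by apply: (eq_partial c oU _ Uu) => w Uw; exact: (christoffelC oU symG).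
have gC e f h := christoffelC oU symG e f h Uu.
pose dg c e f h := partial c (christoffel G e f h) u.
pose g e f h := christoffel G e f h u.
have {pC}: forall c e f h, dg c e f h = dg c e h f by [].
have {gC}: forall e f h, g e f h = g e h f by [].
(* Only the symmetry in the lower indices matters, so the symbols and their derivatives are replaced
   by arbitrary functions with that symmetry. *)
suff : forall (dg : 'I_n -> 'I_n -> 'I_n -> 'I_n -> R) (g : 'I_n -> 'I_n -> 'I_n -> R),
    (forall e f h, g e f h = g e h f) -> (forall c e f h, dg c e f h = dg c e h f) ->
    (dg k i l j - dg l i k j + \sum_m (g i k m * g m l j - g i l m * g m k j))
    + (dg l i j k - dg j i l k + \sum_m (g i l m * g m j k - g i j m * g m l k))
    + (dg j i k l - dg k i j l + \sum_m (g i j m * g m k l - g i k m * g m j l)) = 0.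
  exact.
move=> {}dg {}g gC pC; rewrite (pC k i j l) (pC l i k j) (pC j i l k) !sumrB.
have sC e f h : \sum_m g i e m * g m f h = \sum_m g i e m * g m h f.
  by apply: eq_bigr => m _; rewrite (gC m f h).
rewrite (sC k j l) (sC l k j) (sC j l k); ring.
Qed.

(** Equality of mixed partials, with the first derivatives of [H] replaced by their prescribed
    values. The p rows count as separate covectors: p = 1 serves for a covector, p = n for a
    bilinear form whose left connection term is absorbed in [N]. The Christoffel terms for the
    derivative index would cancel by torsion-freeness and do not appear. *)
Lemma ricci_identity p (H : 'rV[R]_n -> 'M[R]_(p, n)) (N : 'I_n -> 'rV[R]_n -> 'M[R]_(p, n))
    d a u :
  (forall c, msmooth U (N c)) -> msmooth U H ->
  (forall c w, U w -> mpart c H w = H w *m Gam G c w + N c w) -> U u ->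
  H u *m Rmat G d a u = (mpart a (N d) u - N d u *m Gam G a u)
                        - (mpart d (N a) u - N a u *m Gam G d u).
Proof.
move=> sN sH HN Uu.
have E b c : mpart b (mpart c H) u = H u *m Gam G b u *m Gam G c u
    + N b u *m Gam G c u + H u *m mpart b (Gam G c) u + mpart b (N c) u.
  rewrite (eq_mpart oU b (HN c)) // (mpartD oU) //; last exact: msmoothM.
  by rewrite (mpartM oU) // HN // mulmxDl.
have := mpart_comm oU a d sH Uu; rewrite !E RmatE => /eqP; rewrite -subr_eq0.
move=> /eqP E0; apply/eqP; rewrite -subr_eq0 -[X in _ == X]E0; apply/eqP.
by rewrite !(mulmxDr, mulmxN, mulmxA); mxentries.
Qed.

Lemma ricci_identity2 (H : 'rV[R]_n -> 'M[R]_n) (N : 'I_n -> 'rV[R]_n -> 'M[R]_n) d a u :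
  (forall c, msmooth U (N c)) -> msmooth U H ->
  (forall c w, U w -> cov G H c w = N c w) -> U u ->
  (Rmat G d a u)^T *m H u + H u *m Rmat G d a u
  = cov G (N d) a u - cov G (N a) d u.
Proof.
move=> sN sH HN Uu.
have HN' c w : U w -> mpart c H w =
    H w *m Gam G c w + ((Gam G c w)^T *m H w + N c w).
  move=> Uw; rewrite -(HN c w Uw) /cov; mxentries.
have sN' c : msmooth U (fun w => (Gam G c w)^T *m H w + N c w).
  by apply: msmoothD => //; apply: msmoothM => //; exact: msmooth_tr.
have sT c : msmooth U (fun w => (Gam G c w)^T) by exact: msmooth_tr.
rewrite (ricci_identity d a sN' sH HN' Uu).
rewrite !(mpartD oU) ?(mpartM oU) // ?mpart_tr; try exact: msmoothM.
rewrite !HN' // RmatE /cov. by mxdist; mxentries.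
Qed.

Lemma mul_RmatE i j k l u :
  (G u *m Rmat G k l u) i j = \sum_m G u i m * riemann G m j k l u.
Proof. by rewrite mxE; apply: eq_bigr => m _; rewrite [Rmat _ _ _ _ _ _]mxE. Qed.

Lemma riemann_pair i j k l u : U u ->
  (G u *m Rmat G k l u) i j = (G u *m Rmat G i j u) k l.
Proof.
move=> Uu; pose r i j k l := (G u *m Rmat G k l u) i j.
apply: (@pair_symmetry R 'I_n r) => {i j k l} i j k l; rewrite /r.
(* The metric is parallel, so the right side of its Ricci identity is zero; this is antisymmetry in
   the first pair. *)
- have := ricci_identity2 k l (N := fun _ _ => 0) _ sG _ Uu.
  have s0 : msmooth U (fun=> 0 : 'M[R]_n).
    by move=> ? ?; apply: eq_smooth (smooth_cst oU 0) => // w _; rewrite mxE.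
  move=> /(_ (fun=> s0) (fun c w Uw => cov_G oU symG unitG c Uw)).
  rewrite /cov !mpart_cst !mulmx0 !mul0mx !subrr.
  move=> /(congr1 (fun A : 'M[R]_n => A j i)); rewrite mxaddE [RHS]mxE.
  have -> : (Rmat G k l u)^T *m G u = (G u *m Rmat G k l u)^T.
    by rewrite trmx_mul symG.
  by rewrite [X in X + _]mxE addrC => /eqP; rewrite addr_eq0 => /eqP.
- by rewrite Rmat_antisym mulmxN mxoppE.
- rewrite (mul_RmatE i j) (mul_RmatE i k) (mul_RmatE i l) -!big_split big1 //= => m _; rewrite -!mulrDr.
  by rewrite riemann_cyclic // mulr0.
Qed.

(** The Ricci tensor is a contraction of the lowered curvature with the symmetric inverse metric,
    and pair symmetry exchanges its two free slots. *)
Lemma schouten_sym j k u : U u -> schouten G j k u = schouten G k j u.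
Proof.
move=> Uu; congr (_ * _).
have tr_form b c : ricci G b c u
    = \sum_a \sum_e invmx (G u) a e * (G u *m Rmat G a c u) e b.
  apply: eq_bigr => a _.
  have -> : riemann G a b a c u = (invmx (G u) *m (G u *m Rmat G a c u)) a b.
    by rewrite mulmxA mulVmx ?unitG // mul1mx mxE.
  by rewrite mxE.
rewrite !tr_form exchange_big; apply: eq_bigr => a _; apply: eq_bigr => e _.
rewrite riemann_pair //; congr (_ * _).
have sI : (invmx (G u))^T = invmx (G u) by rewrite trmx_inv symG.
by rewrite -[in LHS]sI mxE.
Qed.

(* The hypothesis says that the curvature agrees with that of constant
   curvature B when its second slot is v; by pair symmetry it then does when
   its last slot is v. *)
Lemma curvature_nullity (B : R) (v : 'rV[R]_n) d u : U u ->
  (forall i k l, \sum_j riemann G i j k l u * v 0 j =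
     B * ((i == k)%:R * (v *m G u) 0 l - (i == l)%:R * (v *m G u) 0 k)) ->
  \sum_a v 0 a *: Rmat G d a u
  = B *: ((delta_mx 0 d)^T *m (v *m G u) - v^T *m row d (G u)).
Proof.
move=> Uu Hv.
have Hlow i k l : \sum_j (G u *m Rmat G k l u) i j * v 0 j =
    B * (G u i k * (v *m G u) 0 l - G u i l * (v *m G u) 0 k).
  transitivity (\sum_m G u i m * \sum_j riemann G m j k l u * v 0 j).
    under eq_bigr do rewrite mul_RmatE mulr_suml.
    rewrite exchange_big; apply: eq_bigr => m _; rewrite mulr_sumr.
    by apply: eq_bigr => j _; rewrite mulrA.
  under eq_bigr do rewrite Hv mulrCA mulrBr.
  rewrite -mulr_sumr; congr (_ * _); rewrite sumrB; congr (_ - _).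
    rewrite (bigD1 k) //= eqxx mul1r big1 ?addr0 // => m /negPf ->.
    by rewrite mul0r mulr0.
  rewrite (bigD1 l) //= eqxx mul1r big1 ?addr0 // => m /negPf ->.
  by rewrite mul0r mulr0.
suff E : G u *m (\sum_a v 0 a *: Rmat G d a u) =
    B *: ((row d (G u))^T *m (v *m G u) - (v *m G u)^T *m row d (G u)).
  have e1 : invmx (G u) *m (row d (G u))^T = (delta_mx 0 d)^T.
    by rewrite tr_row symG // colE mulmxA mulVmx ?unitG // mul1mx trmx_delta.
  have e2 : invmx (G u) *m (v *m G u)^T = v^T.
    by rewrite trmx_mul symG // mulmxA mulVmx ?unitG // mul1mx.
  rewrite -[LHS]mul1mx -(mulVmx (unitG Uu)) -mulmxA E -scalemxAr mulmxBr.
  by rewrite !(mulmxA (invmx _)) e1 e2.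
apply/matrixP => i j; rewrite mulmx_sumr summxE mxscaleE mxaddE mxoppE !outerE !row_entry.
rewrite [(v *m G u) 0 i * _]mulrC -Hlow; apply: eq_bigr => a _.
by rewrite -scalemxAr mxscaleE mulrC riemann_pair.
Qed.

End Curvature.

(** * Prolongation of the metrisability equation with nullity, in one chart *)

Section Prolongation.
Context {R : realType} {n : nat} (G : 'rV[R]_n -> 'M[R]_n) (U : set 'rV[R]_n).
Context (oU : open U) (sG : msmooth U G)
  (symG : forall u, U u -> (G u)^T = G u) (unitG : forall u, U u -> G u \in unitmx).
Implicit Types (u w : 'rV[R]_n) (a b c d i j k l : 'I_n) (om : 'rV[R]_n -> 'rV[R]_n).

Let sGam a : msmooth U (Gam G a).
Proof. exact: msmooth_Gam. Qed.

Let sgr a : msmooth U (fun w => row a (G w)).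
Proof. exact: msmooth_row. Qed.

Lemma msmooth_covf om : msmooth U om -> msmooth U (covf G om).
Proof.
move=> so d c.
have s1 : msmooth U (fun w => mpart d om w - om w *m Gam G d w).
  apply: msmoothD => //; first exact: msmooth_mpart.
  by apply: msmoothN => //; exact: msmoothM.
apply: (eq_smooth oU) (s1 0 c) => // w _.
by rewrite [RHS]mxE.
Qed.

(* For the lowered unweighted tensor H of a solution, the metrisability equation
   reads cov H a = - gsym om a with om the lowered mu. *)
Definition gsym om a w : 'M[R]_n := (row a (G w))^T *m om w + (om w)^T *m row a (G w).

Lemma msmooth_gsym om a : msmooth U om -> msmooth U (gsym om a).
Proof.
by move=> so; apply: msmoothD => //; apply: msmoothM => //; exact: msmooth_tr.
Qed.

(** The index a is held fixed instead of being differentiated as a tensor index, so terms in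
    [row a (Gam G d u)^T] survive; they are symmetric in a and d and drop out of [curvature_H]. *)
Lemma cov_gsym om a d u : msmooth U om -> U u ->
  cov G (fun w => - gsym om a w) d u =
  - ((row a (Gam G d u)^T *m G u)^T *m om u + (om u)^T *m (row a (Gam G d u)^T *m G u)
     + ((row a (G u))^T *m row d (covf G om u) + (row d (covf G om u))^T *m row a (G u))).
Proof.
move=> so Uu; have sot : msmooth U (fun w => (om w)^T) by exact: msmooth_tr.
have sgt : msmooth U (fun w => (row a (G w))^T) by exact: msmooth_tr.
rewrite /cov (mpartN oU) //; last exact: msmooth_gsym.
rewrite (mpartD oU) //; [|exact: msmoothM|exact: msmoothM].
rewrite !(mpartM oU) // !mpart_tr mpart_row (mpart_G oU symG unitG) //.
have -> : mpart d om u = row d (covf G om u) + om u *m Gam G d u.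
  by rewrite row_covf subrK.
rewrite [row a (_ + _)]linearD /= 2!row_mul /gsym.
move: (row a (Gam G d u)^T) (row a (G u)) (row d _) (om u) (Gam G d u) (G u).
by move=> r g X o Y Z; mxdist; mxentries.
Qed.

Context (H : 'rV[R]_n -> 'M[R]_n) (om : 'rV[R]_n -> 'rV[R]_n).
Context (sH : msmooth U H) (som : msmooth U om)
  (symH : forall u, U u -> (H u)^T = H u)
  (covH : forall a u, U u -> cov G H a u = - gsym om a u).

Lemma curvature_H d a u : U u ->
  (Rmat G d a u)^T *m H u + H u *m Rmat G d a u
  = (row a (G u))^T *m row d (covf G om u) + (row d (covf G om u))^T *m row a (G u)
  - ((row d (G u))^T *m row a (covf G om u) + (row a (covf G om u))^T *m row d (G u)).
Proof.
move=> Uu; rewrite (@ricci_identity2 _ _ G U oU sG unitG H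
  (fun c w => - gsym om c w)) // ?cov_gsym //; last first.
  by move=> c; apply: msmoothN => //; exact: msmooth_gsym.
rewrite (row_Gam_sym oU symG d a Uu).
move: (row a (Gam G d u)^T) (row a (G u)) (row d (G u)) (row d _) (row a _) (om u) (G u).
by move=> r g g' X X' o Z; mxentries.
Qed.

Context (B : R) (n_ge2 : (1 < n)%N).
Context (null : forall u, U u -> exists2 v : 'rV[R]_n, v != 0 &
  forall i k l, \sum_j riemann G i j k l u * v 0 j =
     B * ((i == k)%:R * (v *m G u) 0 l - (i == l)%:R * (v *m G u) 0 k)).

(** The trace of nabla om = B H + k G forces this k. Defining it by the formula on all of [U] makes
    it smooth, although the relation is proved pointwise. *)
Definition kap w : R := n%:R^-1 *
  (\tr (invmx (G w) *m covf G om w) - B * \tr (invmx (G w) *m H w)).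

Lemma covf_om u : U u -> covf G om u = B *: H u + kap u *: G u.
Proof.
move=> Uu; have [v v0 Hv] := null Uu.
have Kd d := curvature_nullity oU sG symG unitG d Uu Hv.
pose K := covf G om u - B *: H u.
suff EK : K = (n%:R^-1 * \tr (invmx (G u) *m K)) *: G u.
  apply/eqP; rewrite addrC -subr_eq; apply/eqP; rewrite -/K EK /kap; congr (_ * _ *: _).
  by rewrite /K mulmxBr raddfB /= -scalemxAr mxtraceZ.
apply: (sym_pair_proportional (unitG Uu) (symG Uu) v0) => d.
have E : \sum_a v 0 a *: ((Rmat G d a u)^T *m H u + H u *m Rmat G d a u) =
    (v *m G u)^T *m row d (covf G om u) + (row d (covf G om u))^T *m (v *m G u)
    - ((row d (G u))^T *m (v *m covf G om u) + (v *m covf G om u)^T *m row d (G u)).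
  under eq_bigr do rewrite curvature_H // scalerBr !scalerDr !scalemxAl.
  rewrite sumrB !big_split /=; congr (_ + _ - (_ + _)).
  - rewrite -mulmx_suml mulmx_sum_row linear_sum; congr (_ *m _).
    by apply: eq_bigr => a _; rewrite linearZ.
  - under eq_bigr do rewrite -scalemxAl scalemxAr.
    by rewrite -mulmx_sumr -(mulmx_sum_row v).
  - under eq_bigr do rewrite -scalemxAl scalemxAr.
    by rewrite -mulmx_sumr -(mulmx_sum_row v).
  - rewrite -mulmx_suml mulmx_sum_row linear_sum; congr (_ *m _).
    by apply: eq_bigr => a _; rewrite linearZ.
have E' : \sum_a v 0 a *: ((Rmat G d a u)^T *m H u + H u *m Rmat G d a u) =
    (\sum_a v 0 a *: Rmat G d a u)^T *m H u + H u *m (\sum_a v 0 a *: Rmat G d a u).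
  rewrite linear_sum mulmx_suml mulmx_sumr -big_split /=; apply: eq_bigr => a _.
  by rewrite linearZ /= -scalemxAl -scalemxAr scalerDr.
(* The contracted curvature acts on H by terms of the same shape as those of nabla om in [E],
   multiplied by B. Moved across, they leave the relation for the difference K alone. *)
have L1 : (B *: ((delta_mx 0 d)^T *m (v *m G u) - v^T *m row d (G u)))^T *m H u =
    B *: ((v *m G u)^T *m row d (H u) - (row d (G u))^T *m (v *m H u)).
  rewrite (rowE d (H u)); move: (v *m G u) (row d (G u)) => b g.
  by mxdist; mxentries.
have L2 : H u *m (B *: ((delta_mx 0 d)^T *m (v *m G u) - v^T *m row d (G u))) =
    B *: ((row d (H u))^T *m (v *m G u) - (v *m H u)^T *m row d (G u)).
  have -> : (row d (H u))^T = H u *m (delta_mx 0 d)^T.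
    by rewrite tr_row symH // colE trmx_delta.
  have -> : (v *m H u)^T = H u *m v^T by rewrite trmx_mul symH.
  by rewrite -scalemxAr mulmxBr !mulmxA.
have rK : row d K = row d (covf G om u) - B *: row d (H u).
  by apply/matrixP => i j; rewrite row_entry !mxaddE !mxoppE !mxscaleE !row_entry.
have vK : v *m K = v *m covf G om u - B *: (v *m H u).
  by rewrite mulmxBr -scalemxAr.
move: E; rewrite E' Kd L1 L2 rK vK.
set b := v *m G u; set g := row d (G u); set X := row d (covf G om u).
set h := row d (H u); set xv := v *m covf G om u; set hv := v *m H u => E.
apply/eqP; rewrite -subr_eq0; apply/eqP.
move/eqP: E; rewrite -subr_eq0 => /eqP E; rewrite -[RHS]oppr0 -[X in _ = - X]E.
by mxdist; mxentries.
Qed.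

Let sGi : msmooth U (fun w => invmx (G w)).
Proof. exact: msmooth_invmx. Qed.

Lemma smooth_kap : smooth_on U kap.
Proof.
apply: smoothM => //; first exact: smooth_cst.
apply: smoothD => //.
  by apply: smooth_mxtrace => //; apply: msmoothM => //; exact: msmooth_covf.
apply: smoothN => //; apply: smoothM => //; first exact: smooth_cst.
by apply: smooth_mxtrace => //; exact: msmoothM.
Qed.

Lemma cov_covf_kap a u : U u ->
  cov G (covf G om) a u = - B *: gsym om a u + partial a kap u *: G u.
Proof.
move=> Uu; rewrite /cov (eq_mpart oU a covf_om Uu) covf_om //.
have sB : smooth_on U (fun=> B) by exact: smooth_cst.
rewrite (mpartD oU) //; [|exact: msmoothZ|exact: (msmoothZ oU smooth_kap)].
rewrite (mpartZ oU _ sB) // (mpartZ oU _ smooth_kap) // partial_cst.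
rewrite (mpart_G oU symG unitG) //.
have -> : mpart a H u = (Gam G a u)^T *m H u + H u *m Gam G a u - gsym om a u.
  by rewrite -(covH a Uu) /cov; mxentries.
move: (gsym _ _ _) (kap u) (partial _ _ _) (Gam G a u) (G u) (H u).
by move=> N k k' Y Z X; mxdist; mxentries.
Qed.

Lemma row_outer (x y : 'rV[R]_n) d : row d (x^T *m y) = x 0 d *: y.
Proof. by apply/matrixP => i j; rewrite row_entry outerE mxscaleE (ord1 i). Qed.

(** The factor 2 has two sources: the derivative of B H inside nabla om and the contracted curvature
    applied to om each contribute one B om. The sum [xi] = 2 B om + dk then satisfies the hypothesis
    of [null_covector]. *)
Lemma partial_kap a u : U u -> partial a kap u = - (2 * B * om u 0 a).
Proof.
move=> Uu; have [v v0 Hv] := null Uu.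
(* The derivative of nabla om involves only om, dk and G, so H disappears from the Ricci identity
   for om. *)
have omR d e : om u *m Rmat G d e u =
    partial e kap u *: row d (G u) - partial d kap u *: row e (G u)
    - B *: (om u 0 d *: row e (G u) - om u 0 e *: row d (G u)).
  have sX := msmooth_covf som.
  rewrite (@ricci_identity _ _ G U oU sG unitG _ om (fun c w => row c (covf G om w))) //;
    [|by move=> c; exact: msmooth_row|by move=> c w _; rewrite row_covf addrC subrK].
  have mX c : mpart c (covf G om) u = cov G (covf G om) c u
      + (Gam G c u)^T *m covf G om u + covf G om u *m Gam G c u.
    by rewrite /cov; mxentries.
  have rX c f : row c (mpart f (covf G om) u) - row c (covf G om u) *m Gam G f u =
      - B *: (G u f c *: om u + om u 0 c *: row f (G u)) + partial f kap u *: row c (G u)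
      + row c (Gam G f u)^T *m covf G om u.
    rewrite mX cov_covf_kap // /gsym -!row_mul.
    rewrite -[in RHS](row_entry (G u) f 0 c) -!row_outer.
    by apply/matrixP => i j; rewrite ?(mxaddE, mxoppE, mxscaleE, row_entry); ring.
  rewrite !mpart_row !rX (row_Gam_sym oU symG d e Uu).
  have -> : G u e d = G u d e by rewrite -[in LHS](symG Uu) mxE.
  move: (partial e _ u) (partial d _ u) (row d (G u)) (row e (G u)) (om u 0 d) (om u 0 e)
    (_ *m _) => k k' g g' o o' Z.
  by mxentries.
pose xi : 'rV[R]_n := \row_c (2 * B * om u 0 c + partial c kap u).
suff xi0 : xi = 0.
  have := congr1 (fun x : 'rV[R]_n => x 0 a) xi0; rewrite !mxE => /eqP.
  by rewrite addrC addr_eq0 => /eqP.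
apply: (null_covector (unitG Uu) v0 n_ge2) => d.
have Kd := curvature_nullity oU sG symG unitG d Uu Hv.
have := congr1 (mulmx (om u)) Kd.
rewrite mulmx_sumr -scalemxAr mulmxBr !mulmxA.
under eq_bigr do rewrite -scalemxAr omR.
have -> : om u *m (delta_mx 0 d)^T = (om u 0 d)%:M.
  by rewrite trmx_delta -colE [LHS]mx11_scalar mxE.
have -> : om u *m v^T = (\sum_c v 0 c * om u 0 c)%:M.
  rewrite [LHS]mx11_scalar mxE; congr (_ %:M); apply: eq_bigr => c _.
  by rewrite mxE mulrC.
have -> : (xi *m v^T) 0 0 = 2 * B * (\sum_c v 0 c * om u 0 c)
    + \sum_c v 0 c * partial c kap u.
  rewrite mxE mulr_sumr -big_split; apply: eq_bigr => c _ /=; rewrite !mxE; ring.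
rewrite mul_scalar_mx -scalemxAl mul_scalar_mx.
have sumE (p o : 'I_n -> R) (p' o' : R) (g : 'rV[R]_n) (L : 'M[R]_n) :
    \sum_c v 0 c *: (p c *: g - p' *: row c L - B *: (o' *: row c L - o c *: g)) =
    (\sum_c v 0 c * p c) *: g - p' *: (v *m L)
    - B *: (o' *: (v *m L) - (\sum_c v 0 c * o c) *: g).
  rewrite mulmx_sum_row !scaler_suml !scaler_sumr -!sumrB scaler_sumr -sumrB.
  by apply: eq_bigr => c _; mxentries.
rewrite (sumE (fun c => partial c kap u) (fun c => om u 0 c)).
move=> E; rewrite [xi 0 d]mxE.
move: (\sum_c v 0 c * om u 0 c) (\sum_c v 0 c * partial c kap u) E => c1 c2 E.
apply/matrixP => i j; have := congr1 (fun A : 'rV[R]_n => A i j) E.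
rewrite ?(mxaddE, mxoppE, mxscaleE) => e; lra.
Qed.

Lemma cov_covf a u : U u ->
  cov G (covf G om) a u = - B *: (gsym om a u + (2 * om u 0 a) *: G u).
Proof. by move=> Uu; rewrite cov_covf_kap // partial_kap //; mxentries. Qed.

End Prolongation.

(** * From Weyl nullity to constant-curvature contractions *)

Section Nullity.
Context {R : realType} {n : nat} (G : 'rV[R]_n -> 'M[R]_n) (U : set 'rV[R]_n).
Context (oU : open U) (sG : msmooth U G)
  (symG : forall u, U u -> (G u)^T = G u) (unitG : forall u, U u -> G u \in unitmx).

(** Where the Weyl tensor dies, only Schouten terms remain, and they have eigenvalue B on v.
    Symmetry of the Schouten tensor enters because the Weyl tensor contracts its first slot with v,
    while B is read off from the second. *)
Lemma weyl_nullity_curvature (B : R) (v u : 'rV[R]_n) : U u ->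
  (forall i k l, \sum_j weyl G i j k l u * v 0 j = 0) ->
  (forall i, \sum_j schouten_up G i j u * v 0 j = B * v 0 i) ->
  forall i k l, \sum_j riemann G i j k l u * v 0 j =
     B * ((i == k)%:R * (v *m G u) 0 l - (i == l)%:R * (v *m G u) 0 k).
Proof.
move=> Uu Wv Pv i k l.
have Sv m : \sum_j schouten G j m u * v 0 j = B * (v *m G u) 0 m.
  pose P : 'M[R]_n := \matrix_(a, b) schouten G a b u.
  have PE : invmx (G u) *m P *m v^T = B *: v^T.
    apply/colP => a; rewrite mxscaleE [v^T _ _]mxE -Pv mxE; apply: eq_bigr => b _.
    rewrite [v^T _ _]mxE mxE /schouten_up; congr (_ * _).
    by apply: eq_bigr => c _; rewrite mxE.
  have := congr1 (fun A : 'cV[R]_n => (G u *m A) m 0) PE.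
  rewrite !mulmxA mulmxV ?unitG // mul1mx -scalemxAr mxscaleE.
  have -> : (G u *m v^T) m 0 = (v *m G u) 0 m.
    by rewrite -[in RHS](symG Uu) -[in RHS](trmxK v) -trmx_mul [RHS]mxE.
  move=> <-; rewrite mxE; apply: eq_bigr => j _.
  by rewrite !mxE (schouten_sym oU sG symG unitG).
have -> : \sum_j riemann G i j k l u * v 0 j =
    \sum_j weyl G i j k l u * v 0 j
    - (i == l)%:R * (\sum_j schouten G j k u * v 0 j)
    + (i == k)%:R * (\sum_j schouten G j l u * v 0 j).
  rewrite !mulr_sumr -sumrB -big_split; apply: eq_bigr => j _ /=.
  by rewrite /weyl; ring.
by rewrite Wv !Sv; ring.
Qed.

End Nullity.

(** * Weighted bivectors, lowered tensors and functions in one chart *)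

Section ChartCorrespondence.
Context {R : realType} {n : nat} (G : 'rV[R]_n -> 'M[R]_n) (U : set 'rV[R]_n).
Context (oU : open U) (sG : msmooth U G)
  (symG : forall u, U u -> (G u)^T = G u) (unitG : forall u, U u -> G u \in unitmx).
Implicit Types (u w : 'rV[R]_n) (a b c d i j k l : 'I_n) (F : 'rV[R]_n -> R)
  (s H : 'rV[R]_n -> 'M[R]_n).

Definition dform F u : 'rV[R]_n := \row_a partial a F u.

(** Passage from unweighted forms to bivectors of weight -2 in the scale of g; [lower] undoes it.
    Both the inverse metric and [dens] are parallel, so the passage commutes with covariant
    derivatives, which is [nabla_raise]. *)
Definition raise H u : 'M[R]_n :=
  dens G u *: (invmx (G u) *m H u *m invmx (G u)).

Definition lower s u : 'M[R]_n := (dens G u)^-1 *: (G u *m s u *m G u).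

(* Normalised so that its differential is mu. *)
Definition half_trace s u : R := - 2^-1 * ((dens G u)^-1 * \tr (G u *m s u)).

Let sGi : msmooth U (fun w => invmx (G w)).
Proof. exact: msmooth_invmx. Qed.

Let d0 u : U u -> dens G u != 0.
Proof. by move=> Uu; rewrite gt_eqF //; exact: (dens_gt0 unitG). Qed.

Let sdens : smooth_on U (dens G).
Proof. exact: smooth_dens. Qed.

Lemma msmooth_dform F : smooth_on U F -> msmooth U (dform F).
Proof.
move=> sF i j; apply: (eq_smooth oU) (smooth_partial j sF) => // w _.
by rewrite mxE.
Qed.

Lemma msmooth_lower s : msmooth U s -> msmooth U (lower s).
Proof.
move=> ss; apply: msmoothZ => //; first exact: smoothV.
by apply: msmoothM => //; exact: msmoothM.
Qed.

Lemma msmooth_raise H : msmooth U H -> msmooth U (raise H).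
Proof.
by move=> sH; apply: msmoothZ => //; apply: msmoothM => //; exact: msmoothM.
Qed.

Lemma raise_lower s u : U u -> raise (lower s) u = s u.
Proof.
move=> Uu; rewrite /raise /lower -scalemxAr -scalemxAl scalerA mulfV ?d0 // scale1r.
by rewrite !mulmxA mulVmx ?unitG // mul1mx -mulmxA mulmxV ?unitG // mulmx1.
Qed.

Lemma half_trace_raise H u : U u ->
  half_trace (raise H) u = - 2^-1 * \tr (invmx (G u) *m H u).
Proof.
move=> Uu; rewrite /half_trace /raise -scalemxAr mxtraceZ mulKf ?d0 //.
by rewrite !mulmxA mulmxV ?unitG // mul1mx mxtrace_mulC.
Qed.

Lemma smooth_half_trace s : msmooth U s -> smooth_on U (half_trace s).
Proof.
move=> ss; apply: smoothM => //; first exact: smooth_cst.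
apply: smoothM => //; first exact: smoothV.
by apply: smooth_mxtrace => //; exact: msmoothM.
Qed.

Lemma eq_half_trace s t u : s u = t u -> half_trace s u = half_trace t u.
Proof. by rewrite /half_trace => ->. Qed.

Lemma nabla_raise H a u : msmooth U H -> U u ->
  \matrix_(b, c) nabla_bivector_m2 G (raise H) a b c u
  = dens G u *: (invmx (G u) *m cov G H a u *m invmx (G u)).
Proof.
move=> sH Uu.
have sHG : msmooth U (fun w => invmx (G w) *m H w) by exact: msmoothM.
have -> : \matrix_(b, c) nabla_bivector_m2 G (raise H) a b c u =
    mpart a (raise H) u + Gam G a u *m raise H u + raise H u *m (Gam G a u)^T
    - (2 / n.+1%:R * \tr (Gam G a u)) *: raise H u.
  apply/matrixP => b c; rewrite mxE !mxaddE mxoppE mxscaleE mpartE.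
  rewrite /nabla_bivector_m2; congr (_ + _ + _ - _ * _ * _).
  - by rewrite mxE; apply: eq_bigr => k _; rewrite GamE.
  - by rewrite mxE; apply: eq_bigr => k _; rewrite [_^T _ _]mxE GamE mulrC.
  - by apply: eq_bigr => k _; rewrite GamE (christoffelC oU symG).
rewrite /raise (mpartZ oU _ sdens) //; last exact: msmoothM.
rewrite (mpartM oU) // (mpartM oU) // (mpart_invG oU sG symG unitG) //.
rewrite (partial_dens oU sG symG unitG) // /cov.
move: (dens G u) (\tr (Gam G a u)) (invmx (G u)) (Gam G a u) (mpart a H u) (H u) => e t I Y M X.
by mxdist; mxentries.
Qed.

(** Contracting delta_a^b m^c + delta_a^c m^b over a = b gives (n+1) m^c, which explains the
    normalisation of [trace_free]. *)
Lemma trace_freeP (T : 'I_n -> 'I_n -> 'I_n -> R) (m : 'rV[R]_n) :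
  (forall a b c, T a b c = - ((a == b)%:R * m 0 c + (a == c)%:R * m 0 b)) ->
  forall a b c, trace_free T a b c = 0.
Proof.
move=> Tm; have trT c : \sum_d T d d c = - (n.+1%:R * m 0 c).
  under eq_bigr do rewrite Tm eqxx mul1r.
  rewrite sumrN big_split /= sumr_const card_ord (bigD1 c) //= eqxx mul1r.
  rewrite big1 ?addr0 => [|d /negPf ->]; last by rewrite mul0r.
  by rewrite -mulr_natl -[n.+1]addn1 natrD; ring.
move=> a b c; rewrite /trace_free !trT Tm.
have n0 : n.+1%:R != 0 :> R by rewrite pnatr_eq0.
by move: n0; set N := n.+1%:R => n0; field.
Qed.

Lemma mul_invG_row a u : U u -> invmx (G u) *m (row a (G u))^T = (delta_mx 0 a)^T.
Proof.
move=> Uu; rewrite tr_row symG // colE mulmxA mulVmx ?unitG // mul1mx.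
by rewrite trmx_delta.
Qed.

Lemma row_mul_invG a u : U u -> row a (G u) *m invmx (G u) = delta_mx 0 a.
Proof. by move=> Uu; rewrite -row_mul mulmxV ?unitG // rowE mulmx1. Qed.

Lemma trace_gsym om a u : U u ->
  \tr (invmx (G u) *m gsym G om a u) = 2 * om u 0 a.
Proof.
move=> Uu; rewrite /gsym mulmxDr mxtraceD !mulmxA mul_invG_row //.
rewrite [X in _ + X]mxtrace_mulC mulmxA row_mul_invG // [X in X + _]mxtrace_mulC.
rewrite trmx_delta -colE -rowE !trace_mx11 !mxE; ring.
Qed.

Lemma eq_nabla_bivector s s' a b c u : (forall w, U w -> s w = s' w) -> U u ->
  nabla_bivector_m2 G s a b c u = nabla_bivector_m2 G s' a b c u.
Proof.
move=> ss' Uu; have ss'bc w : U w -> s w b c = s' w b c by move=> Uw; rewrite ss'.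
by rewrite /nabla_bivector_m2 (ss' u Uu) (eq_partial a oU ss'bc Uu).
Qed.

(** Here [m] is the value of mu at the single point u. [gsym] only evaluates its covector field, so
    freezing [m] inside the field is harmless. *)
Lemma cov_lower s (m : 'rV[R]_n) a u : msmooth U s -> U u ->
  (forall b c, nabla_bivector_m2 G s a b c u
     = - ((a == b)%:R * m 0 c + (a == c)%:R * m 0 b)) ->
  cov G (lower s) a u = - gsym G (fun w => (dens G w)^-1 *: (m *m G w)) a u.
Proof.
move=> ss Uu Hm.
have E := nabla_raise a (msmooth_lower ss) Uu.
have E' : \matrix_(b, c) nabla_bivector_m2 G (raise (lower s)) a b c u
    = - ((delta_mx 0 a)^T *m m + m^T *m (delta_mx 0 a)).
  apply/matrixP => b c; rewrite mxE mxoppE mxaddE !outerE !mxE !eqxx /=.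
  rewrite [b == a]eq_sym [c == a]eq_sym [m 0 b * _]mulrC -Hm.
  by apply: eq_nabla_bivector => // w; exact: raise_lower.
have -> : cov G (lower s) a u = (dens G u)^-1 *: (G u *m (dens G u *: (invmx (G u)
    *m cov G (lower s) a u *m invmx (G u))) *m G u).
  rewrite -scalemxAr -scalemxAl scalerA mulVf ?d0 // scale1r !mulmxA mulmxV ?unitG //.
  by rewrite mul1mx -mulmxA mulVmx ?unitG // mulmx1.
rewrite -E E' /gsym rowE; move: (dens G u)^-1 (delta_mx 0 a) (G u) (symG Uu).
by move=> e d g sg; mxdist; rewrite !sg; mxentries.
Qed.

Lemma dform_half_trace s (m : 'rV[R]_n) u : msmooth U s -> U u ->
  (forall a b c, nabla_bivector_m2 G s a b c u
     = - ((a == b)%:R * m 0 c + (a == c)%:R * m 0 b)) ->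
  dform (half_trace s) u = (dens G u)^-1 *: (m *m G u).
Proof.
move=> ss Uu Hm; apply/rowP => a; rewrite mxE.
rewrite (eq_partial a oU (K := fun w => - 2^-1 * \tr (invmx (G w) *m lower s w))) //.
  have sL := msmooth_lower ss.
  have sT : smooth_on U (fun w => \tr (invmx (G w) *m lower s w)).
    by apply: smooth_mxtrace => //; exact: msmoothM.
  rewrite partialM //; last exact: smooth_diff sT Uu.
  rewrite partial_cst mulr0 addr0 (partial_trace oU sG symG unitG) //.
  rewrite (cov_lower ss Uu (Hm a)) mulmxN raddfN /= trace_gsym //.
  by rewrite mulrN mulNr opprK mulrA mulVf ?mul1r // pnatr_eq0.
by move=> w Uw; rewrite -half_trace_raise //; apply: eq_half_trace; rewrite raise_lower.
Qed.

Context (B : R) (B0 : B != 0) (n_ge2 : (1 < n)%N).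

(* The inverse correspondence: the trace-free Hessian of F over B, with the
   trace that makes half_trace return F. *)
Definition hess_comb F u : 'M[R]_n :=
  let X := covf G (dform F) u in
  B^-1 *: X - (n%:R^-1 * (B^-1 * \tr (invmx (G u) *m X) + 2 * F u)) *: G u.

Lemma msmooth_hess_comb F : smooth_on U F -> msmooth U (hess_comb F).
Proof.
move=> sF; have sX := msmooth_covf oU sG unitG (msmooth_dform sF).
apply: msmoothD => //; first by apply: msmoothZ => //; exact: smooth_cst.
apply: msmoothN => //; apply: msmoothZ => //.
apply: smoothM => //; first exact: smooth_cst.
apply: smoothD => //; last by apply: smoothM => //; exact: smooth_cst.
apply: smoothM => //; first exact: smooth_cst.
by apply: smooth_mxtrace => //; exact: msmoothM.
Qed.

Let n0 : n%:R != 0 :> R.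
Proof. by rewrite pnatr_eq0 -lt0n; exact: ltnW. Qed.

Let trGG u : U u -> \tr (invmx (G u) *m G u) = n%:R.
Proof. by move=> Uu; rewrite mulVmx ?unitG // mxtrace1. Qed.

Lemma half_trace_hess F u : U u -> half_trace (raise (hess_comb F)) u = F u.
Proof.
move=> Uu; rewrite half_trace_raise // /hess_comb /=.
rewrite mulmxBr raddfB /= -!scalemxAr !mxtraceZ trGG //.
move: (\tr _) (F u) => t f; field.
by rewrite B0 n0.
Qed.

Lemma covf_sym F u : smooth_on U F -> U u ->
  (covf G (dform F) u)^T = covf G (dform F) u.
Proof.
move=> sF Uu; apply/matrixP => i j; rewrite mxE -!nabla_formE /nabla_form.
congr (_ - _).
  rewrite (eq_partial _ oU (K := partial i F)) // => [|w _]; last by rewrite mxE.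
  rewrite (partial_comm _ _ oU sF Uu).
  by apply: (eq_partial _ oU) => // w _; rewrite mxE.
by apply: eq_bigr => k _; rewrite (christoffelC oU symG).
Qed.

Lemma cov_hess_comb F a u : smooth_on U F -> U u ->
  (forall d, cov G (covf G (dform F)) d u
    = - B *: (gsym G (dform F) d u + (2 * dform F u 0 d) *: G u)) ->
  cov G (hess_comb F) a u = - gsym G (dform F) a u.
Proof.
move=> sF Uu HG; set X := covf G (dform F) in HG *.
have sX : msmooth U X by exact: (msmooth_covf oU sG unitG (msmooth_dform sF)).
pose h w := - (n%:R^-1 * (B^-1 * \tr (invmx (G w) *m X w) + 2 * F w)).
have sT : smooth_on U (fun w => \tr (invmx (G w) *m X w)).
  by apply: smooth_mxtrace => //; exact: msmoothM.
have sc (x : R) : smooth_on U (fun=> x) by exact: smooth_cst.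
have sh : smooth_on U h.
  apply: smoothN => //; apply: smoothM => //.
  by apply: smoothD => //; apply: smoothM.
have hE w : hess_comb F w = B^-1 *: X w + h w *: G w by rewrite scaleNr.
(* The trace of the Gallot-Obata-Tanno equation is -2(n+1)B dF; with the term 2F this gives dh = 2
   dF, exactly cancelling the g_bc term of the equation divided by B. *)
have dh : partial a h u = 2 * dform F u 0 a.
  have dT := smooth_diff sT Uu; have dF := smooth_diff sF Uu.
  have -> : h = fun w => (- n%:R^-1) * (B^-1 * \tr (invmx (G w) *m X w) + 2 * F w).
    by apply/funext => w; rewrite mulNr.
  have pc (c : R) K : differentiable K u -> partial a (fun w => c * K w) u = c * partial a K u.
    by move=> dK; rewrite partialM // partial_cst mulr0 addr0.
  have dT' : differentiable (fun w => B^-1 * \tr (invmx (G w) *m X w)) u.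
    exact: differentiableM.
  have dF' : differentiable (fun w => 2 * F w) u by exact: differentiableM.
  rewrite pc; last exact: differentiableD.
  rewrite (partialD a dT' dF') (pc _ _ dT) (pc _ _ dF).
  rewrite (partial_trace oU sG symG unitG) // HG -scalemxAr mxtraceZ mulmxDr mxtraceD.
  rewrite trace_gsym // -scalemxAr mxtraceZ trGG // [dform F u 0 a]mxE.
  move: (partial a F u) => p; field.
  by rewrite ?B0 ?n0.
have covX := HG a; move: covX; rewrite /cov.
have -> : mpart a (hess_comb F) u = B^-1 *: mpart a X u
    + ((2 * dform F u 0 a) *: G u + h u *: mpart a G u).
  rewrite (eq_mpart oU a (B := fun w => B^-1 *: X w + h w *: G w)) //.
  rewrite (mpartD oU) //; [|exact: msmoothZ|exact: msmoothZ].
  by rewrite (mpartZ oU _ (sc B^-1)) // (mpartZ oU _ sh) // partial_cst scale0r add0r dh.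
rewrite (mpart_G oU symG unitG) // hE.
have bb : B^-1 * B = 1 by rewrite mulVf.
move: (gsym _ _ _ _) (2 * _) (h u) (Gam G a u) (mpart a X u) (X u) (G u).
move=> N k k' Y M Z g E.
have -> : M = - B *: (N + k *: g) + Y^T *m Z + Z *m Y by rewrite -E; mxentries.
mxdist; apply/matrixP => i j; rewrite ?(mxaddE, mxoppE, mxscaleE).
move: bb (N i j) (k * g i j); move: (B^-1) => B' bb x y.
rewrite !mulrDr !mulrA mulrN bb; ring.
Qed.

End ChartCorrespondence.

(** * Behaviour under a change of coordinates *)

Section ChartChange.
Context {R : realType} {n : nat} (U V : set 'rV[R]_n) (t : 'rV[R]_n -> 'rV[R]_n).
Context (oU : open U) (oV : open V) (tUV : forall u, U u -> V (t u))
  (st : forall p, smooth_on U (fun w => t w 0 p)).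
Implicit Types (u w : 'rV[R]_n) (a b c d i j k l p r : 'I_n).

Definition jacm u : 'M[R]_n := \matrix_(i, j) partial j (fun w => t w 0 i) u.

Lemma msmooth_jacm : msmooth U jacm.
Proof.
move=> i j; apply: (eq_smooth oU) (smooth_partial j (st i)) => // w _.
by rewrite mxE.
Qed.

Lemma mpart_jacm_sym a b i u : U u -> mpart a jacm u i b = mpart b jacm u i a.
Proof.
move=> Uu; rewrite !mpartE.
transitivity (partial a (partial b (fun w => t w 0 i)) u).
  by apply: (eq_partial _ oU) => // w _; rewrite mxE.
rewrite (partial_comm _ _ oU (st i) Uu).
by apply: (eq_partial _ oU) => // w _; rewrite mxE.
Qed.

Lemma mpart_comp {q s} (A : 'rV[R]_n -> 'M[R]_(q, s)) a u : msmooth V A -> U u ->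
  mpart a (fun w => A (t w)) u = \sum_r jacm u r a *: mpart r A (t u).
Proof.
move=> sA Uu; apply/matrixP => i j; rewrite mpartE summxE.
rewrite -[LHS]/(partial a ((fun w => A w i j) \o t) u) partial_comp.
- by apply: eq_bigr => r _; rewrite mxscaleE mpartE mulrC [jacm _ _ _]mxE.
- by move=> p; exact: smooth_diff (st p) Uu.
- by apply: smooth_diff (sA i j) _; exact: tUV.
Qed.

Context (Gc Gd : 'rV[R]_n -> 'M[R]_n).
Context (sGc : msmooth U Gc) (symGc : forall u, U u -> (Gc u)^T = Gc u)
  (unitGc : forall u, U u -> Gc u \in unitmx).
Context (sGd : msmooth V Gd) (symGd : forall u, V u -> (Gd u)^T = Gd u)
  (unitGd : forall u, V u -> Gd u \in unitmx).
Context (GcE : forall u, U u -> Gc u = (jacm u)^T *m Gd (t u) *m jacm u).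

Lemma unit_jacm u : U u -> jacm u \in unitmx.
Proof.
by move=> Uu; have := unitGc Uu; rewrite GcE // unitmx_mul => /andP[].
Qed.

Lemma comp_metricE u : U u ->
  Gd (t u) = (invmx (jacm u))^T *m Gc u *m invmx (jacm u).
Proof.
move=> Uu; rewrite GcE // trmx_inv !mulmxA mulVmx ?unitmx_tr ?unit_jacm // mul1mx.
by rewrite -mulmxA mulmxV ?unit_jacm // mulmx1.
Qed.

Let sJ := msmooth_jacm.

Let sJi : msmooth U (fun w => invmx (jacm w)).
Proof. by apply: msmooth_invmx => //; exact: unit_jacm. Qed.

(** Expressing the composite through [Gc] and the Jacobian reduces its smoothness to closure under
    products and inverses. *)
Let sGdt : msmooth U (fun w => Gd (t w)).
Proof.
apply: (eq_msmooth oU (A := fun w => (invmx (jacm w))^T *m Gc w *m invmx (jacm w))).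
  by move=> w Uw; rewrite comp_metricE.
by apply: msmoothM => //; apply: msmoothM => //; exact: msmooth_tr.
Qed.

(** The lowered difference of the two connections is antisymmetric in its last two indices by
    compatibility and symmetric in the first and third by torsion-freeness; such a tensor is
    zero. *)
Lemma levi_civita_unique (C : 'I_n -> 'M[R]_n) u : U u ->
  (forall a b i, C a i b = C b i a) ->
  (forall a, mpart a Gc u = (C a)^T *m Gc u + Gc u *m C a) ->
  forall a, C a = Gam Gc a u.
Proof.
move=> Uu symC metC a.
pose T a := Gc u *m (C a - Gam Gc a u).
suff T0 : T a = 0.
  apply/eqP; rewrite -subr_eq0; apply/eqP.
  by rewrite -[LHS]mul1mx -(mulVmx (unitGc Uu)) -mulmxA -/(T a) T0 mulmx0.
have T1 d b c : T d b c = - T d c b.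
  have := mpart_G oU symGc unitGc d Uu; rewrite metC => /eqP; rewrite -subr_eq0.
  move=> /eqP E; apply/eqP; rewrite -subr_eq0 opprK.
  have -> : T d b c + T d c b = (T d + (T d)^T) b c by rewrite mxaddE [_^T _ _]mxE.
  suff -> : T d + (T d)^T = 0 by rewrite mxE.
  by rewrite -[RHS]E /T; mxdist; rewrite symGc //; mxentries.
have T2 d b c : T d b c = T c b d.
  rewrite !mxE; apply: eq_bigr => i _; rewrite !(mxaddE, mxoppE) (symC d) !GamE.
  by rewrite (christoffelC oU symGc).
apply/matrixP => b c; rewrite [RHS]mxE.
have := T2 a b c; have := T1 c b a; have := T2 c a b; have := T1 b a c.
have := T2 b c a; have := T1 a c b; lra.
Qed.

(** Obtained from uniqueness instead of the Christoffel formula: the right side is torsion-free,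
    since second derivatives of the transition commute, and compatible with the pulled-back
    metric. *)
Lemma Gam_change a u : U u -> Gam Gc a u = invmx (jacm u) *m
  (mpart a jacm u + (\sum_r jacm u r a *: Gam Gd r (t u)) *m jacm u).
Proof.
move=> Uu; pose C a := invmx (jacm u) *m
  (mpart a jacm u + (\sum_r jacm u r a *: Gam Gd r (t u)) *m jacm u).
symmetry; apply: (levi_civita_unique (C := C) Uu) => {a} [a b i|a].
  rewrite !mxE; apply: eq_bigr => k _; rewrite !mxaddE mpart_jacm_sym //.
  congr (_ * (_ + _)); rewrite mulmx_suml mulmx_suml !summxE.
  under eq_bigr do rewrite -scalemxAl mxscaleE [(_ *m _) _ _]mxE mulr_sumr.
  under [RHS]eq_bigr do rewrite -scalemxAl mxscaleE [(_ *m _) _ _]mxE mulr_sumr.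
  rewrite exchange_big; apply: eq_bigr => r _; apply: eq_bigr => q _.
  rewrite !GamE (christoffelC oV symGd); last exact: tUV.
  ring.
have VG := symGd (tUV Uu).
pose D := \sum_r jacm u r a *: Gam Gd r (t u).
have E1 : mpart a (fun w => Gd (t w)) u = D^T *m Gd (t u) + Gd (t u) *m D.
  rewrite mpart_comp // linear_sum mulmx_suml mulmx_sumr -big_split /=.
  apply: eq_bigr => r _; rewrite (mpart_G oV symGd unitGd); last exact: tUV.
  by rewrite scalerDr [(_ *: _)^T]linearZ /= -scalemxAl -scalemxAr.
have sJt : msmooth U (fun w => (jacm w)^T) by exact: msmooth_tr.
rewrite (eq_mpart oU a GcE Uu) (mpartM oU) //; last exact: msmoothM.
rewrite (mpartM oU) // mpart_tr E1 GcE // /C -/D.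
have -> : (jacm u)^T *m Gd (t u) *m jacm u *m (invmx (jacm u) *m
    (mpart a jacm u + D *m jacm u)) =
    (jacm u)^T *m Gd (t u) *m (mpart a jacm u + D *m jacm u).
  by rewrite mulmxA -[X in X *m _ = _]mulmxA mulmxV ?unit_jacm // mulmx1.
have -> : (invmx (jacm u) *m (mpart a jacm u + D *m jacm u))^T *m
    ((jacm u)^T *m Gd (t u) *m jacm u) =
    (mpart a jacm u + D *m jacm u)^T *m Gd (t u) *m jacm u.
  rewrite trmx_mul trmx_inv !mulmxA -[X in X *m _ *m _ = _]mulmxA.
  by rewrite mulVmx ?unitmx_tr ?unit_jacm // mulmx1.
clear E1; clearbody D; move: (jacm u) (mpart a jacm u) (Gd (t u)) => J J' Z.
by mxdist; mxentries.
Qed.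

Context (Fc Fd : 'rV[R]_n -> R) (sFc : smooth_on U Fc) (sFd : smooth_on V Fd).
Context (FcE : forall u, U u -> Fc u = Fd (t u)).

Lemma dform_change u : U u -> dform Fc u = dform Fd (t u) *m jacm u.
Proof.
move=> Uu; apply/rowP => a; rewrite mxE (eq_partial a oU FcE Uu).
rewrite -[LHS]/(partial a (Fd \o t) u) partial_comp.
- by rewrite mxE; apply: eq_bigr => r _; rewrite !mxE.
- by move=> p; exact: smooth_diff (st p) Uu.
- by apply: smooth_diff sFd _; exact: tUV.
Qed.

(** The derivative of the Jacobian in d(om J) cancels against the inhomogeneous term of
    [Gam_change], leaving a tensor law. *)
Lemma covf_change u : U u -> covf Gc (dform Fc) u =
  (jacm u)^T *m covf Gd (dform Fd) (t u) *m jacm u.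
Proof.
move=> Uu; have sdt : msmooth U (fun w => dform Fd (t w)).
  apply: (eq_msmooth oU (A := fun w => dform Fc w *m invmx (jacm w))).
    by move=> w Uw; rewrite dform_change // -mulmxA mulmxV ?unit_jacm // mulmx1.
  by apply: msmoothM => //; exact: msmooth_dform.
apply/row_matrixP => a; rewrite row_covf !row_mul Gam_change //.
rewrite (eq_mpart oU a dform_change Uu) (mpartM oU) // dform_change //.
rewrite mpart_comp; [|exact: msmooth_dform|exact: Uu].
rewrite -[dform Fd (t u) *m jacm u *m _]mulmxA [jacm u *m (_ *m _)]mulmxA.
rewrite mulmxV ?unit_jacm // mul1mx mulmxDr opprD addrA addrK.
rewrite mulmxA -mulmxBl; congr (_ *m _).
rewrite mulmx_sumr -sumrB mulmx_sum_row; apply: eq_bigr => r _.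
by rewrite row_covf [row a _ _ _]mxE [_^T _ _]mxE scalerBr -scalemxAr.
Qed.

Lemma invmx_change u : U u ->
  invmx (Gd (t u)) = jacm u *m invmx (Gc u) *m (jacm u)^T.
Proof.
move=> Uu; have uJ := unit_jacm Uu; have uG := unitGd (tUV Uu).
suff E : Gd (t u) *m (jacm u *m invmx (Gc u) *m (jacm u)^T) = 1%:M.
  by rewrite -[RHS]mul1mx -(mulVmx uG) -[RHS]mulmxA E mulmx1.
rewrite comp_metricE // !mulmxA -[_ *m invmx (jacm u) *m jacm u]mulmxA mulVmx // mulmx1.
rewrite -[_ *m Gc u *m invmx _]mulmxA mulmxV ?unitGc // mulmx1.
by rewrite -trmx_mul mulmxV // trmx1.
Qed.

(** Thus [dens] is a global section of E(-2): det g scales by (det J)^2, and the power 1/(n+1)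
    matches the factor required of a weight -2 field. *)
Lemma dens_change u : U u ->
  dens Gc u = (`|\det (jacm u)| `^ (- 2 / n.+1%:R))^-1 * dens Gd (t u).
Proof.
move=> Uu; rewrite /dens GcE // !det_mulmx det_tr.
set x := \det (jacm u); set y := \det (Gd (t u)).
have n0 : n.+1%:R != 0 :> R by rewrite pnatr_eq0.
rewrite mulNr powRN invrK (_ : (x * y * x) ^+ 2 = (x ^+ 2) ^+ 2 * y ^+ 2); last by ring.
rewrite powRM ?sqr_ge0 //; congr (_ * _).
rewrite -[x ^+ 2]real_normK ?num_real // -exprM -powR_mulrn // -powRrM; congr (_ `^ _).
by move: n0; set N := n.+1%:R => n0; field.
Qed.

Lemma dens_ratio u : U u ->
  (dens Gc u)^-1 = `|\det (jacm u)| `^ (- 2 / n.+1%:R) * (dens Gd (t u))^-1.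
Proof. by move=> Uu; rewrite dens_change // invfM invrK. Qed.

(** The weight of [s] cancels that of the inverse density, and the contraction with g is invariant;
    this is why the half traces glue to a function on M. *)
Lemma half_trace_change (s s' : 'rV[R]_n -> 'M[R]_n) u : U u ->
  s' (t u) = `|\det (jacm u)| `^ (- 2 / n.+1%:R) *: (jacm u *m s u *m (jacm u)^T) ->
  half_trace Gc s u = half_trace Gd s' (t u).
Proof.
move=> Uu E; rewrite /half_trace E dens_ratio // -scalemxAr mxtraceZ GcE //.
have -> : \tr ((jacm u)^T *m Gd (t u) *m jacm u *m s u) =
    \tr (Gd (t u) *m (jacm u *m s u *m (jacm u)^T)).
  by rewrite -!mulmxA mxtrace_mulC !mulmxA.
by ring.
Qed.

Context (B : R).

Lemma hess_comb_change u : U u ->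
  hess_comb Gc B Fc u = (jacm u)^T *m hess_comb Gd B Fd (t u) *m jacm u.
Proof.
move=> Uu; rewrite /hess_comb covf_change // FcE //.
have -> : \tr (invmx (Gc u) *m ((jacm u)^T *m covf Gd (dform Fd) (t u) *m jacm u)) =
    \tr (invmx (Gd (t u)) *m covf Gd (dform Fd) (t u)).
  by rewrite invmx_change // !mulmxA mxtrace_mulC !mulmxA.
rewrite GcE //; move: (_ * (_ + _)) => k.
by mxdist; mxentries.
Qed.

Lemma raise_change (H H' : 'rV[R]_n -> 'M[R]_n) u : U u ->
  H u = (jacm u)^T *m H' (t u) *m jacm u ->
  raise Gd H' (t u) =
    `|\det (jacm u)| `^ (- 2 / n.+1%:R) *: (jacm u *m raise Gc H u *m (jacm u)^T).
Proof.
move=> Uu E; rewrite /raise dens_change // E -scalemxAr -scalemxAl scalerA mulrA.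
rewrite mulfV ?mul1r; last first.
  by rewrite powR_eq0 negb_and normr_eq0 -unitfE -unitmxE unit_jacm.
by rewrite invmx_change // !mulmxA.
Qed.

End ChartChange.

(** * Both directions of the correspondence in one chart *)

Section ChartSolutions.
Context {R : realType} {n : nat} (G : 'rV[R]_n -> 'M[R]_n) (U : set 'rV[R]_n).
Context (oU : open U) (sG : msmooth U G)
  (symG : forall u, U u -> (G u)^T = G u) (unitG : forall u, U u -> G u \in unitmx).
Context (B : R) (B0 : B != 0) (n_ge2 : (1 < n)%N).
Implicit Types (u w : 'rV[R]_n) (a b c d e i j k l : 'I_n) (F : 'rV[R]_n -> R)
  (s : 'rV[R]_n -> 'M[R]_n).

Lemma GOT_chartP F u : U u ->
  (forall a b e, let df k w := dform F w 0 k in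
    nabla_form2 G (nabla_form G df) a b e u
    + B * (2 * G u b e * df a u + G u a b * df e u + G u e a * df b u) = 0) <->
  (forall a, cov G (covf G (dform F)) a u
    = - B *: (gsym G (dform F) a u + (2 * dform F u 0 a) *: G u)).
Proof.
move=> Uu; have dfE : nabla_form G (fun k w => dform F w 0 k)
    = fun b c w => covf G (dform F) w b c.
  by apply/funext => b; apply/funext => c; apply/funext => w; rewrite nabla_formE.
have gE a b e : (- B *: (gsym G (dform F) a u + (2 * dform F u 0 a) *: G u)) b e =
    - (B * (2 * G u b e * dform F u 0 a + G u a b * dform F u 0 e
            + G u e a * dform F u 0 b)).
  rewrite mxscaleE mxaddE mxscaleE /gsym mxaddE !outerE !row_entry.
  have -> : G u e a = G u a e by rewrite -[in LHS](symG Uu) mxE.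
  ring.
split=> [H a|H a b e df].
  apply/matrixP => b e; rewrite gE -nabla_form2E -dfE.
  by apply/eqP; rewrite -addr_eq0; apply/eqP; exact: H.
by rewrite dfE nabla_form2E H gE addNr.
Qed.

Lemma forward_chart s (m : 'rV[R]_n -> 'rV[R]_n) F :
  (forall u, U u -> exists2 v : 'rV[R]_n, v != 0 &
    forall i k l, \sum_j riemann G i j k l u * v 0 j =
      B * ((i == k)%:R * (v *m G u) 0 l - (i == l)%:R * (v *m G u) 0 k)) ->
  msmooth U s -> (forall u, U u -> (s u)^T = s u) ->
  (forall u, U u -> forall a b c, nabla_bivector_m2 G s a b c u
     = - ((a == b)%:R * m u 0 c + (a == c)%:R * m u 0 b)) ->
  (forall u, U u -> F u = half_trace G s u) ->
  [/\ smooth_on U F,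
      forall u, U u -> dform F u = (dens G u)^-1 *: (m u *m G u),
      forall u a, U u -> cov G (covf G (dform F)) a u
        = - B *: (gsym G (dform F) a u + (2 * dform F u 0 a) *: G u)
    & forall u, U u -> raise G (hess_comb G B F) u = s u].
Proof.
move=> null ss syms Hm FE.
have sF : smooth_on U F.
  apply: eq_smooth (smooth_half_trace oU sG unitG ss) => // u /FE; exact: esym.
have dF u : U u -> dform F u = (dens G u)^-1 *: (m u *m G u).
  move=> Uu; rewrite -(dform_half_trace oU sG symG unitG ss Uu (Hm u Uu)).
  by apply/rowP => a; rewrite [LHS]mxE [RHS]mxE (eq_partial a oU FE Uu).
have sL := msmooth_lower oU sG unitG ss.
have covL a u : U u -> cov G (lower G s) a u = - gsym G (dform F) a u.
  move=> Uu; rewrite (cov_lower oU sG symG unitG ss Uu (Hm u Uu a)).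
  by rewrite /gsym dF.
have symL u : U u -> (lower G s u)^T = lower G s u.
  by move=> Uu; rewrite /lower mxtrZ !trmx_mul symG // syms // mulmxA.
have sdF := msmooth_dform oU sF.
split=> // [u a Uu|u Uu].
  exact: (cov_covf oU sG symG unitG sL sdF symL covL n_ge2 null).
rewrite -[RHS](raise_lower unitG s Uu) /raise; congr (_ *: (_ *m _ *m _)).
have -> : hess_comb G B F u = B^-1 *: covf G (dform F) u
    - (n%:R^-1 * (B^-1 * \tr (invmx (G u) *m covf G (dform F) u) + 2 * F u)) *: G u by [].
have -> : F u = - 2^-1 * \tr (invmx (G u) *m lower G s u).
  rewrite -(half_trace_raise unitG _ Uu) FE //; apply: eq_half_trace.
  by rewrite (raise_lower unitG).
(* This relation is solved for the lowered [s] by dividing by B; the trace of the lowered [s] inside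
   [kap] equals -2F and yields the trace term of [hess_comb]. *)
have := covf_om oU sG symG unitG sL sdF symL covL null Uu; rewrite /kap.
move: (\tr (invmx (G u) *m covf _ _ _)) (\tr (invmx (G u) *m lower G s u)).
move: (covf _ _ _) (lower _ _ _) (G u) => X L g tX tL EX.
apply/matrixP => i j; have := congr1 (fun A : 'M[R]_n => A i j) EX.
rewrite ?(mxaddE, mxoppE, mxscaleE) => ->.
have n0 : n%:R != 0 :> R by rewrite pnatr_eq0 -lt0n; exact: ltnW.
by field; rewrite ?n0 ?B0.
Qed.

Lemma backward_chart F : smooth_on U F ->
  (forall u a, U u -> cov G (covf G (dform F)) a u
    = - B *: (gsym G (dform F) a u + (2 * dform F u 0 a) *: G u)) ->
  [/\ msmooth U (raise G (hess_comb G B F)),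
      forall u, U u -> (raise G (hess_comb G B F) u)^T = raise G (hess_comb G B F) u
    & forall u a b c, U u -> trace_free (fun a' b' c' =>
        nabla_bivector_m2 G (raise G (hess_comb G B F)) a' b' c' u) a b c = 0].
Proof.
move=> sF HF; have sH := msmooth_hess_comb oU sG unitG B sF.
split=> [|u Uu|u a b c Uu].
- exact: (msmooth_raise oU sG unitG sH).
- have symH : (hess_comb G B F u)^T = hess_comb G B F u.
    rewrite /hess_comb /= mxtrD mxtrN !mxtrZ (covf_sym oU symG sF Uu).
    by rewrite symG.
  by rewrite /raise mxtrZ !trmx_mul trmx_inv symG // symH mulmxA.
(* The witness is dF with its index raised and given weight -2, which is mu in the scale of g. *)
apply: (trace_freeP (m := dens G u *: (dform F u *m invmx (G u)))) => {}a {}b {}c.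
have := congr1 (fun A : 'M[R]_n => A b c) (nabla_raise oU sG symG unitG a sH Uu).
rewrite [LHS]mxE => ->.
rewrite (cov_hess_comb oU sG symG unitG B0 n_ge2 a sF Uu (fun d => HF u d Uu)).
rewrite mulmxN mulNmx scalerN mxoppE /gsym mulmxDr mulmxDl !mulmxA.
rewrite (mul_invG_row symG unitG) // -(mulmxA _ (row a _)) (row_mul_invG unitG) //.
have -> : invmx (G u) *m (dform F u)^T = (dform F u *m invmx (G u))^T.
  by rewrite trmx_mul trmx_inv symG.
rewrite -[_ *m dform F u *m _]mulmxA mxscaleE mxaddE !outerE; congr (- _).
rewrite mulrDr !mxscaleE !mxE eqxx /= ![_ == a]eq_sym.
ring.
Qed.

End ChartSolutions.

(** * Gluing the chart constructions over the manifold *)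

Section Correspondence.
Context {R : realType} {n : nat} {M : manifold R n} (g : metric M) (B : R).
Implicit Types (c d : charts M) (s : field2 M) (f : M -> R).

Let oC c : open (chart_img (atlas c)) := @img_open _ _ _ (atlas c).
Let sg c : msmooth (chart_img (atlas c)) (g c) := @metric_smooth _ _ _ g c.
Let symg c u : chart_img (atlas c) u -> (g c u)^T = g c u := @Defs.metric_sym _ _ _ g c u.
Let unitg c u : chart_img (atlas c) u -> g c u \in unitmx :=
  @metric_nondeg _ _ _ g c u.

Lemma open_overlap c d : open (overlap (atlas c) (atlas d)).
Proof.
rewrite openE => u [Uu Du]; apply: filterI.
  by apply: open_nbhs_nbhs; split=> //; exact: oC.
apply: (point_continuous Uu).
by apply: open_nbhs_nbhs; split=> //; exact: dom_open.
Qed.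

Section Overlap.
Context (c d : charts M).
Let O := overlap (atlas c) (atlas d).
Let t := transition (atlas c) (atlas d).

Let tO u : O u -> chart_img (atlas d) (t u).
Proof. by move=> [_ Du]; exact: coord_img. Qed.

Let O_img u : O u -> chart_img (atlas c) u.
Proof. by case. Qed.

Let gE u : O u -> g c u = (jacm t u)^T *m g d (t u) *m jacm t u.
Proof. exact: metric_change. Qed.

Lemma half_trace_overlap s u : is_section_S2TM_m2 s -> O u ->
  half_trace (g c) (s c) u = half_trace (g d) (s d) (t u).
Proof.
move=> [_ _ _ chs] Ou.
exact: (half_trace_change gE Ou (chs c d u Ou)).
Qed.

Lemma raise_hess_overlap f u : smooth_function f -> O u ->
  raise (g d) (hess_comb (g d) B (f \o chart_point (atlas d))) (t u) =
  (`|\det (jac (atlas c) (atlas d) u)| `^ (- 2 / n.+1%:R)) *: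
    (jac (atlas c) (atlas d) u
     *m raise (g c) (hess_comb (g c) B (f \o chart_point (atlas c))) u
     *m (jac (atlas c) (atlas d) u)^T).
Proof.
move=> sf Ou; have oO := @open_overlap c d.
have sub : O `<=` chart_img (atlas c) by move=> w [].
have sgO : msmooth O (g c) by move=> i j; apply: (smooth_sub sub); exact: sg.
have st p : smooth_on O (fun w => t w 0 p) by exact: atlas_smooth.
have uO w : O w -> g c w \in unitmx by move=> Ow; exact: unitg (O_img Ow).
have yO w : O w -> (g c w)^T = g c w by move=> Ow; exact: symg (O_img Ow).
apply: (raise_change (t := t) tO uO (@unitg d) gE Ou).
have sfd : smooth_on (chart_img (atlas d)) (f \o chart_point (atlas d)) by exact: sf.
have sfc : smooth_on O (f \o chart_point (atlas c)).
  by apply: (smooth_sub sub); exact: sf.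
have fE w : O w -> (f \o chart_point (atlas c)) w = (f \o chart_point (atlas d)) (t w).
  by move=> [_ Dw] /=; rewrite /t /transition coordK.
exact: (hess_comb_change oO (@oC d) tO st sgO yO uO (@sg d) (@symg d) (@unitg d) gE
  sfc sfd fE B Ou).
Qed.

End Overlap.

Definition chart_at (x : M) : charts M := projT1 (cid (atlas_cover x)).

Lemma chart_atP (x : M) : chart_dom (atlas (chart_at x)) x.
Proof. exact: projT2 (cid (atlas_cover x)). Qed.

(** Evaluated in an arbitrarily chosen chart; for a section [trace_funE] shows that every chart
    gives the same value. *)
Definition trace_fun s (x : M) : R :=
  half_trace (g (chart_at x)) (s (chart_at x)) (chart_coord (atlas (chart_at x)) x).

Lemma trace_funE s c u : is_section_S2TM_m2 s -> chart_img (atlas c) u ->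
  trace_fun s (chart_point (atlas c) u) = half_trace (g c) (s c) u.
Proof.
move=> ss Uu; rewrite (@half_trace_overlap c (chart_at (chart_point (atlas c) u))) //.
by split=> //; exact: chart_atP.
Qed.

(** The value 0 off the chart image is the convention of [is_section_S2TM_m2], under which equality
    of sections is equality of component families. *)
Definition hess_field f : field2 M := fun c u =>
  if `[< chart_img (atlas c) u >]
  then raise (g c) (hess_comb (g c) B (f \o chart_point (atlas c))) u else 0.

Lemma hess_fieldE f c u : chart_img (atlas c) u ->
  hess_field f c u = raise (g c) (hess_comb (g c) B (f \o chart_point (atlas c))) u.
Proof. by move=> Uu; rewrite /hess_field; case: asboolP. Qed.

Lemma GOT_solutionsP (Bg : M -> R) f : (forall x, Bg x = B) ->
  GOT_solutions g Bg f <-> smooth_function f /\ forall c u a, chart_img (atlas c) u ->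
    let F := f \o chart_point (atlas c) in
    cov (g c) (covf (g c) (dform F)) a u
    = - B *: (gsym (g c) (dform F) a u + (2 * dform F u 0 a) *: g c u).
Proof.
move=> HB; split=> -[sf E]; split=> //.
  move=> c u a Uu F; apply: ((GOT_chartP (@symg c) B F Uu).1 _ a) => a' b e.
  by have := E c u Uu a' b e; rewrite HB.
move=> c u Uu a b e; rewrite HB.
exact: ((GOT_chartP (@symg c) B (f \o chart_point (atlas c)) Uu).2 (fun a => E c u a Uu)).
Qed.

Context (B0 : B != 0) (n_ge2 : (1 < n)%N).

Lemma hess_field_solution (Bg : M -> R) f : (forall x, Bg x = B) ->
  GOT_solutions g Bg f -> metrisability_solutions g (hess_field f).
Proof.
move=> HB /(GOT_solutionsP _ HB)[sf E].
have bw c := backward_chart (@oC c) (@sg c) (@symg c) (@unitg c) B0 n_ge2 (sf c)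
  (fun u a Uu => E c u a Uu).
split; last first.
  move=> c u Uu a b e; have [_ _ /(_ u a b e Uu) <-] := bw c.
  congr (trace_free _ a b e); apply/funext => a'; apply/funext => b'.
  apply/funext => e'; apply: (eq_nabla_bivector _ (@oC c)) => // w.
  exact: hess_fieldE.
split=> [c u nUu|c u Uu|c a b|c d u Ou J].
- by rewrite /hess_field; case: asboolP.
- by rewrite hess_fieldE //; have [_ ->] := bw c.
- have [sr _ _] := bw c; apply: (eq_smooth (@oC c)) (sr a b) => u Uu.
  by rewrite hess_fieldE.
- have [Uu Du] := Ou; rewrite !hess_fieldE //; last exact: coord_img.
  exact: raise_hess_overlap.
Qed.

Lemma trace_fun_hess f : trace_fun (hess_field f) = f.
Proof.
apply/funext => x; have Dx := chart_atP x; have Ix := coord_img Dx.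
rewrite /trace_fun (eq_half_trace _ (hess_fieldE f Ix)).
by rewrite (half_trace_hess (@unitg (chart_at x)) B0 n_ge2) //= coordK.
Qed.

Lemma metrisability_mu s c u a b e : metrisability_equation g s ->
  chart_img (atlas c) u -> nabla_bivector_m2 (g c) (s c) a b e u
    = - ((a == b)%:R * mu g s c u 0 e + (a == e)%:R * mu g s c u 0 b).
Proof.
move=> Es Uu; have := Es c u Uu a b e; rewrite /trace_free !mxE => /eqP.
rewrite subr_eq0 => /eqP ->; ring.
Qed.

Lemma metrisability_forward s :
  (forall c u, chart_img (atlas c) u -> exists2 v : 'rV[R]_n, v != 0 &
    forall i k l, \sum_j riemann (g c) i j k l u * v 0 j =
      B * ((i == k)%:R * (v *m g c u) 0 l - (i == l)%:R * (v *m g c u) 0 k)) ->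
  metrisability_solutions g s ->
  let F c := trace_fun s \o chart_point (atlas c) in forall c,
  [/\ smooth_on (chart_img (atlas c)) (F c),
      forall u, chart_img (atlas c) u ->
        dform (F c) u = (dens (g c) u)^-1 *: (mu g s c u *m g c u),
      forall u a, chart_img (atlas c) u -> cov (g c) (covf (g c) (dform (F c))) a u
        = - B *: (gsym (g c) (dform (F c)) a u + (2 * dform (F c) u 0 a) *: g c u)
    & forall u, chart_img (atlas c) u ->
        raise (g c) (hess_comb (g c) B (F c)) u = s c u].
Proof.
move=> null [ss Es] F c; have [_ syms sms _] := ss.
apply: (forward_chart (@oC c) (@sg c) (@symg c) (@unitg c) B0 n_ge2 (null c) (sms c)
  (syms c)) => [u Uu a b e|u Uu].
  exact: metrisability_mu.
exact: trace_funE.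
Qed.

End Correspondence.

Theorem proposition4p15 (R : realType) (n : nat) (n_ge2 : (2 <= n)%N)
    (M : manifold R n) (m : set (metric M))
    (m_proj : metric_projective_structure m) (m_null : has_weyl_nullity m)
    (g : metric M) (g_m : m g)
    (Bg : M -> R) (Bg_def : nullity_function m g Bg)
    (B : R) (B_neq0 : B != 0) (Bg_const : forall x, Bg x = B) :
  exists Phi : field2 M -> (M -> R),
    [/\ set_bij (metrisability_solutions g) (GOT_solutions g Bg) Phi,
        (forall (a : R) (s t : field2 M),
           metrisability_solutions g s -> metrisability_solutions g t ->
           forall x, Phi (fun c u => a *: s c u + t c u) x
                     = a * Phi s x + Phi t x)
      & forall s : field2 M, metrisability_solutions g s ->
          forall (x : M) (c : charts M), chart_dom (atlas c) x ->
            (mu g s c (chart_coord (atlas c) x) != 0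
             <-> differential (Phi s) c (chart_coord (atlas c) x) != 0)].
Proof.
have null c u : chart_img (atlas c) u -> exists2 v : 'rV[R]_n, v != 0 &
    forall i k l, \sum_j riemann (g c) i j k l u * v 0 j =
      B * ((i == k)%:R * (v *m g c u) 0 l - (i == l)%:R * (v *m g c u) 0 k).
  move=> Uu; have Dx := point_dom Uu; have [v v0 Wv] := m_null _ _ Dx.
  exists v => //; have Pv := Bg_def _ _ Dx _ Wv; rewrite pointK // in Wv Pv.
  apply: (weyl_nullity_curvature (@img_open _ _ _ (atlas c)) (@metric_smooth _ _ _ g c)
    (@Defs.metric_sym _ _ _ g c) (@metric_nondeg _ _ _ g c) Uu).
    exact: Wv.
  by move=> i; rewrite Pv Bg_const.
have fw := metrisability_forward B_neq0 n_ge2 null.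
have hess_trace s : metrisability_solutions g s ->
    hess_field g B (trace_fun g s) = s.
  move=> ms; apply/funext => c; apply/funext => u.
  have [Uu|nUu] := pselect (chart_img (atlas c) u).
    by rewrite hess_fieldE //; have [_ _ _ ->] := fw _ ms c.
  (* Off the chart image both sides are 0 by convention. *)
  have [[s0 _ _ _] _] := ms; rewrite s0 // /hess_field; by case: asboolP.
exists (trace_fun g); split; first split.
- move=> s ms; apply/(GOT_solutionsP g _ Bg_const); split=> [c|c u a Uu F].
    by have [] := fw _ ms c.
  by have [_ _ + _] := fw _ ms c; exact.
(* Injectivity follows from the left inverse [hess_field]; the same map is a right inverse and gives
   surjectivity. *)
- by move=> s t /set_mem ms /set_mem mt st; rewrite -(hess_trace s) // st hess_trace.
- move=> f Gf; exists (hess_field g B f); last exact: trace_fun_hess.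
  exact: (hess_field_solution B_neq0 n_ge2 Bg_const Gf).
- move=> a s t _ _ x; rewrite /trace_fun /half_trace mulmxDr -scalemxAr.
  by rewrite mxtraceD mxtraceZ; ring.
(* In each chart the differential is mu times the invertible matrix of g, up to a positive density
   factor, so both vanish at the same points. *)
move=> s ms x c Dx; have Uu := coord_img Dx; have [_ dE _ _] := fw _ ms c.
have := dE _ Uu; rewrite /dform -/(differential _ _ _) => ->.
have d0 := dens_gt0 (@metric_nondeg _ _ _ g c) Uu.
rewrite scaler_eq0 invr_eq0 (gt_eqF d0) /=.
set u := chart_coord _ _; have ug : g c u \in unitmx by exact: metric_nondeg.
split; apply: contra_neq => E; last by rewrite E mul0mx.
by rewrite -[LHS]mulmx1 -(mulmxV ug) mulmxA E mul0mx.
Qed.
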